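(* Let $P, Q \in \mathbf{C}[x,y]$ and let $f = (P,Q) : \mathbf{C}^2_{(x,y)} \to \mathbf{C}^2_{(u,v)}$. Suppose that the Jacobian $J(P,Q) := P_x Q_y - P_y Q_x$ is a nonzero constant. Suppose that $\deg P = Kd$ and $\deg Q = Ke$ with $K, d, e$ positive integers and $\gcd(d,e) = 1$, and that $P$ and $Q$ have the form $$P(x,y) = A y^{Kd} + \dots + a_1(x) y + a_0(x), \quad A \neq 0, \qquad Q(x,y) = B y^{Ke} + \dots + b_1(x) y + b_0(x), \quad B \neq 0,$$ where $A, B \in \mathbf{C}$ are constants and the $a_i(x), b_j(x) \in \mathbf{C}[x]$ (so the coefficient of the top power of $y$ in each of $P$, $Q$ is a nonzero constant). If the non-proper value set $A_f$ is not empty, then every irreducible component of $A_f$ can be parameterized by a polynomial map of the form $$\xi \mapsto \big(A\xi^{md} + \text{terms of lower degree in } \xi,\; B\xi^{me} + \text{terms of lower degree in } \xi\big), \qquad m \in \mathbf{N}.$$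
   Context: For a dominant polynomial map $f : \mathbf{C}^2 \to \mathbf{C}^2$, the non-proper value set $A_f$ is the set of all points $a \in \mathbf{C}^2$ such that $f^{-1}(K)$ is not compact for every compact neighbourhood $K \subset \mathbf{C}^2$ of $a$ (equivalently, there is a sequence $p_i \in \mathbf{C}^2$ with $p_i \to \infty$ and $f(p_i) \to a$). When non-empty, $A_f$ is a plane algebraic curve. *)

(* Defs.v *)
(* The complex numbers are  R[i] = complex R  for an
   arbitrary  R : realType  (mathcomp-real-closed's complex numbers over a
   complete archimedean real closed field, i.e. C). *)
From mathcomp Require Import all_boot all_order all_algebra.
From mathcomp Require Import reals.
From mathcomp Require Export complex.
Set Implicit Arguments. Unset Strict Implicit. Unset Printing Implicit Defensive.
Import Order.TTheory GRing.Theory Num.Theory.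
Local Open Scope ring_scope.

(* Bivariate polynomials in C[x,y] are represented as polynomials in y
   whose coefficients are polynomials in x:  P = \sum_i a_i(x) y^i. *)
Section Bivariate.
Variable R : realType.
Local Notation C := (R[i]).

Definition eval2 (P : {poly {poly C}}) (x y : C) : C := (P.[y%:P]).[x].

Definition dx (P : {poly {poly C}}) : {poly {poly C}} := map_poly (@deriv C) P.
Definition dy (P : {poly {poly C}}) : {poly {poly C}} := deriv P.

Definition jacobian (P Q : {poly {poly C}}) : {poly {poly C}} :=
  dx P * dy Q - dy P * dx Q.

(* total degree of a nonzero bivariate polynomial: max of deg_x a_i + i over
   the nonzero coefficients a_i (0 for the zero polynomial) *)
Definition totdeg (P : {poly {poly C}}) : nat :=
  \max_(i < size P | nth 0%R P i != 0%R) ((size (nth 0%R P i)).-1 + i)%N.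

Definition RtoC (r : R) : C := Complex r 0.

Definition tends_to_infty (p : nat -> C * C) : Prop :=
  forall M : R, exists N : nat, forall n, (N <= n)%N ->
    RtoC M < `|(p n).1| + `|(p n).2|.

Definition converges_to (q : nat -> C * C) (a : C * C) : Prop :=
  forall e : R, 0 < e -> exists N : nat, forall n, (N <= n)%N ->
    `|(q n).1 - a.1| + `|(q n).2 - a.2| < RtoC e.

Definition nonproper_set (P Q : {poly {poly C}}) : C * C -> Prop :=
  fun a => exists p : nat -> C * C, tends_to_infty p /\
    converges_to (fun n => (eval2 P (p n).1 (p n).2, eval2 Q (p n).1 (p n).2)) a.

Definition zariski_closed (Z : C * C -> Prop) : Prop :=
  exists F : {poly {poly C}} -> Prop,
    forall z, Z z <-> (forall G, F G -> eval2 G z.1 z.2 = 0).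

Definition irreducible_closed (Z : C * C -> Prop) : Prop :=
  zariski_closed Z /\ (exists z, Z z) /\
  forall Z1 Z2 : C * C -> Prop, zariski_closed Z1 -> zariski_closed Z2 ->
    (forall z, Z z <-> (Z1 z \/ Z2 z)) ->
    (forall z, Z z <-> Z1 z) \/ (forall z, Z z <-> Z2 z).

Definition irreducible_component (S Z : C * C -> Prop) : Prop :=
  irreducible_closed Z /\ (forall z, Z z -> S z) /\
  forall W, irreducible_closed W -> (forall z, W z -> S z) ->
    (forall z, Z z -> W z) -> forall z, W z -> Z z.
End Bivariate.

(* Main.v *)
(** Put x = 1/t and y = w/t: the map becomes (t^-Kd F, t^-Ke G) with F, G
    polynomial, and the non-proper values are its cluster values as t tends to 0
    with w bounded.  In these coordinates the Jacobian condition says that a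
    weighted Jacobian of F and G is a monomial c t^r.  Where F(0,w) and G(0,w)
    have a common root, r > 0, so d p q' = e p' q for p = F(0,w), q = G(0,w);
    hence p^e and q^d are proportional and root multiplicities are in the ratio
    d : e.  Substituting t = t'^l, w = z + t'^k w' at each common root z, with
    the slope k/l of the Newton polygon but never so steep that the pole orders
    become negative, preserves this situation with smaller data.  Both pole
    orders a d, a e reach 0 simultaneously, and there the cluster values form the
    curve (p', q') with deg p' : deg q' = d : e and
    lead(p')^e : lead(q')^d = A^e : B^d.  So A_f is a finite union of such
    polynomial curves, which are closed and irreducible; rescaling the parameter
    normalises the leading coefficients to A and B. *)
Require Import Defs.
From mathcomp Require Import all_boot all_order all_algebra reals complex.
From mathcomp Require Import boolp ring zify.
Set Implicit Arguments. Unset Strict Implicit. Unset Printing Implicit Defensive.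
Import Order.TTheory GRing.Theory Num.Theory.
Local Open Scope ring_scope.

(** * The weighted Jacobian *)

Section WeightedJacobian.
Variable C : numClosedFieldType.
Implicit Types (F G : {poly {poly C}}) (t w c : C).

Definition ev F t w : C := (F.[w%:P]).[t].

Lemma ev_coef F t w n : (size F <= n)%N ->
  ev F t w = \sum_(j < n) (F`_j).[t] * w ^+ j.
Proof.
move=> sF; rewrite /ev (horner_coef_wide _ sF) horner_sum.
by apply: eq_bigr => j _; rewrite hornerM -rmorphXn hornerC.
Qed.

Lemma evD F G t w : ev (F + G) t w = ev F t w + ev G t w.
Proof. by rewrite /ev !hornerD. Qed.
Lemma evB F G t w : ev (F - G) t w = ev F t w - ev G t w.
Proof. by rewrite /ev !(hornerD, hornerN). Qed.
Lemma evN F t w : ev (- F) t w = - ev F t w.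
Proof. by rewrite /ev !hornerN. Qed.
Lemma evM F G t w : ev (F * G) t w = ev F t w * ev G t w.
Proof. by rewrite /ev !hornerM. Qed.
Lemma evMn F n t w : ev (F *+ n) t w = ev F t w *+ n.
Proof. by rewrite /ev !hornerMn. Qed.
Lemma evC (a : {poly C}) t w : ev a%:P t w = a.[t].
Proof. by rewrite /ev hornerC. Qed.
Lemma evX t w : ev 'X t w = w.
Proof. by rewrite /ev hornerX hornerC. Qed.
Lemma evXn n t w : ev 'X^n t w = w ^+ n.
Proof. by rewrite /ev hornerXn -rmorphXn hornerC. Qed.

Definition evE := (evD, evN, evM, evMn, evC, evX, evXn).

(** The substitutions below rescale [w] and change [t] without mixing powers of [w], so an identity
    between evaluations can be checked coefficient by coefficient. *)
Lemma ev_transfer F G t s w r c c' :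
  (forall j, (F`_j).[t] * c = c' * ((G`_j).[s] * r ^+ j)) ->
  ev F t w * c = c' * ev G s (r * w).
Proof.
move=> FG; pose n := maxn (size F) (size G).
rewrite (@ev_coef F _ _ n) ?leq_maxl // (@ev_coef G _ _ n) ?leq_maxr //.
rewrite mulr_suml mulr_sumr; apply: eq_bigr => j _.
by rewrite mulrAC FG exprMn !mulrA.
Qed.

Lemma poly_eq0_off0 (p : {poly C}) : (forall t, t != 0 -> p.[t] = 0) -> p = 0.
Proof.
move=> p0; apply/eqP/contraT => nzp.
have /closed_nonrootP [x] : p * 'X != 0 by rewrite mulf_neq0 ?polyX_eq0.
rewrite /root hornerM hornerX mulf_eq0 negb_or => /andP [px x0].
by rewrite p0 ?eqxx in px.
Qed.

Lemma horner_map_eval F t w : (map_poly (horner_eval t) F).[w] = ev F t w.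
Proof.
rewrite (@ev_coef _ _ _ (size F)) // (@horner_coef_wide _ (size F)) ?size_poly //.
by apply: eq_bigr => j _; rewrite coef_map.
Qed.

(** C is infinite, so values determine a polynomial; excluding [t = 0] leaves room for dividing by
    powers of [t]. *)
Lemma ev_inj_off0 F G :
  (forall t w, t != 0 -> ev F t w = ev G t w) -> F = G.
Proof.
move=> FG; apply/eqP; rewrite -subr_eq0; apply/eqP/polyP => j; rewrite coef0.
apply: poly_eq0_off0 => t t0.
have -> : ((F - G)`_j).[t] = (map_poly (horner_eval t) (F - G))`_j by rewrite coef_map.
rewrite [map_poly _ _]poly_eq0_off0 ?coef0 // => w _.
by rewrite horner_map_eval evB FG // subrr.
Qed.

Definition at0 F : {poly C} := map_poly (horner_eval 0) F.

Lemma coef_at0 F j : (at0 F)`_j = (F`_j).[0].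
Proof. by rewrite coef_map. Qed.

Lemma at0E F w : (at0 F).[w] = ev F 0 w.
Proof. exact: horner_map_eval. Qed.

(* The operator t d/dt - n, that is t^(n+1) d/dt t^(-n). *)
Definition euler n F : {poly {poly C}} :=
  map_poly (fun c : {poly C} => c^`() * 'X - c *+ n) F.

Lemma coef_euler n F j : (euler n F)`_j = (F`_j)^`() * 'X - F`_j *+ n.
Proof. by rewrite coef_map_id0 // linear0 mul0r mul0rn subr0. Qed.

(* t^(n+m+1) times the Jacobian of (t^-n F, t^-m G) in (t, w). *)
Definition wjac n m F G := euler n F * G^`() - F^`() * euler m G.

Lemma derivXnX (n : nat) : ('X^n : {poly C})^`() * 'X = 'X^n *+ n.
Proof. by case: n => [|n]; rewrite derivXn ?mul0r ?mulr0n // mulrnAl -exprSr. Qed.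

Lemma mulXn_monomial (p : {poly C}) N K c : c != 0 ->
  p * 'X^N = c *: 'X^K -> exists k, p = c *: 'X^k.
Proof.
move=> c0 E; have leNK : (N <= K)%N.
  rewrite leqNgt; apply/negP => ltKN.
  have /polyP/(_ K) := E; rewrite coefMXn ltKN coefZ coefXn eqxx mulr1 => /esym/eqP.
  by apply/negP.
exists (K - N)%N; apply: (@mulIf _ 'X^N); first by rewrite expf_neq0 ?polyX_eq0.
by rewrite E -scalerAl -exprD subnK.
Qed.

(** Serves to cancel the power of [t] that a change of coordinates brings into the weighted
    Jacobian, which thus stays a monomial in [t]. *)
Lemma mulXn_monomial2 F N K c : c != 0 ->
  F * ('X^N)%:P = (c *: 'X^K)%:P -> exists k, F = (c *: 'X^k)%:P.
Proof.
move=> c0 /polyP E; have := E 0%N; rewrite coefMC coefC eqxx.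
case/(mulXn_monomial c0) => k Ek; exists k; apply/polyP => -[|j].
  by rewrite coefC eqxx Ek.
have /eqP := E j.+1; rewrite coefMC !coefC /= mulf_eq0 expf_eq0 polyX_eq0 andbF orbF.
by move/eqP.
Qed.

(* F(t^l, t^k w) = t^N F'(t, w), read off coefficientwise. *)
Definition weighted_pullback k l N F F' :=
  forall j, F'`_j * 'X^N = (F`_j \Po 'X^l) * 'X^(k * j).

Lemma pullback_ev k l N F F' t w : weighted_pullback k l N F F' ->
  ev F' t w * t ^+ N = ev F (t ^+ l) (t ^+ k * w).
Proof.
move=> pb; rewrite -[RHS]mul1r; apply: ev_transfer => j; rewrite mul1r.
have /(congr1 (fun p => p.[t])) := pb j.
by rewrite !hornerM horner_comp !hornerXn exprM.
Qed.

Lemma pullback_deriv k l N F F' t w : weighted_pullback k l N F F' ->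
  ev F'^`() t w * t ^+ N = t ^+ k * ev F^`() (t ^+ l) (t ^+ k * w).
Proof.
move=> pb; apply: ev_transfer => j.
have /(congr1 (fun p => p.[t])) := pb j.+1.
rewrite !coef_deriv !hornerM horner_comp !hornerXn mulnS exprD exprM !hornerMn.
by rewrite mulrnAl => ->; rewrite mulrnAl mulrnAr mulrCA.
Qed.

(** Chain rule: t d/dt of F(t^l, t^k w) is l (t F_t) + k (w F_w) at the new point. Moving t^N across
    the operator turns its constant a' into a' + N = l a. *)
Lemma pullback_euler k l N a a' F F' t w : weighted_pullback k l N F F' ->
  (a' + N = l * a)%N ->
  ev (euler a' F') t w * t ^+ N =
    l%:R * ev (euler a F) (t ^+ l) (t ^+ k * w)
    + k%:R * (t ^+ k * w * ev F^`() (t ^+ l) (t ^+ k * w)).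
Proof.
move=> pb Ea.
have -> : forall s y, l%:R * ev (euler a F) s y + k%:R * (y * ev F^`() s y)
    = 1 * ev (euler a F *+ l + 'X * F^`() *+ k) s y.
  by move=> s y; rewrite !evE mul1r !mulr_natl.
apply: ev_transfer => j; rewrite mul1r.
have -> : (euler a F *+ l + 'X * F^`() *+ k)`_j
   = ((F`_j)^`() * 'X - F`_j *+ a) *+ l + F`_j *+ (k * j).
  rewrite coefD !coefMn coef_euler coefXM coef_deriv.
  by case: j => [|j]; rewrite ?muln0 ?mulr0n ?mul0rn // mulnC mulrnA.
rewrite coef_euler; have := pb j; move: (F`_j) (F'`_j) => f g E.
(* This is t d/dt applied to both sides of [E]. *)
have dE : (g^`() * 'X) * 'X^N + g * 'X^N *+ N =
   ((f^`() * 'X) \Po 'X^l) * 'X^(k * j) *+ l + (f \Po 'X^l) * 'X^(k * j) *+ (k * j).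
  have := congr1 (fun p => p^`() * 'X) E; rewrite !derivM deriv_comp !mulrDl.
  rewrite -[g * _ * 'X]mulrA derivXnX -[(_ \Po _) * _ * 'X]mulrA derivXnX.
  rewrite !mulrnAr => H; rewrite -mulrA ['X * _]mulrC mulrA H; congr (_ + _).
  rewrite comp_polyM comp_polyX.
  have -> : forall x y : {poly C}, x * ('X^l)^`() * y * 'X = x * (('X^l)^`() * 'X) * y.
    by move=> x y; ring.
  by rewrite derivXnX mulrnAr mulrnAl.
have /(congr1 (fun p => p.[t])) := dE.
have /(congr1 (fun p => p.[t])) := E.
rewrite !(hornerM, hornerD, hornerN, hornerMn, horner_comp, hornerXn, hornerX).
rewrite -!exprM => E1 E2.
rewrite mulrBl.
have -> : g^`().[t] * t * t ^+ N - g.[t] *+ a' * t ^+ N =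
  (g^`().[t] * t * t ^+ N + g.[t] * t ^+ N *+ N) - g.[t] * t ^+ N *+ (l * a).
  by rewrite -Ea mulrnDr; ring.
rewrite E2 E1 mulnC mulrnA; ring.
Qed.

(** The terms in w F_w G_w coming from the two Euler operators cancel in the determinant. Up to
    t^(N+M), what remains is l t^k times the old weighted Jacobian at (t^l, t^k w). *)
Lemma wjac_pullback k l N M a a' b b' F F' G G' c K :
  weighted_pullback k l N F F' -> weighted_pullback k l M G G' ->
  (a' + N = l * a)%N -> (b' + M = l * b)%N -> (0 < l)%N -> c != 0 ->
  wjac a b F G = (c *: 'X^K)%:P ->
  exists2 c', c' != 0 & exists K', wjac a' b' F' G' = (c' *: 'X^K')%:P.
Proof.
move=> pbF pbG Ea Eb l0 c0 E; exists (l%:R * c).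
  by rewrite mulf_neq0 // pnatr_eq0 -lt0n.
apply: (@mulXn_monomial2 _ (N + M) (k + l * K)).
  by rewrite mulf_neq0 // pnatr_eq0 -lt0n.
apply: ev_inj_off0 => t w _.
rewrite /wjac !evE hornerZ !hornerXn !exprD.
have -> : forall x y z u s r : C, (x * y - z * u) * (s * r) =
   (x * s) * (y * r) - (z * s) * (u * r) by move=> *; ring.
rewrite (pullback_euler _ _ pbF Ea) (pullback_euler _ _ pbG Eb).
rewrite (pullback_deriv _ _ pbF) (pullback_deriv _ _ pbG).
have := congr1 (fun H => ev H (t ^+ l) (t ^+ k * w)) E.
rewrite /wjac !evE hornerZ hornerXn -exprM => E1.
transitivity (l%:R * t ^+ k * (c * t ^+ (l * K))); last by ring.
by rewrite -E1; ring.
Qed.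

Definition shift z F := F \Po ('X + z%:P%:P).

Lemma ev_shift z F t w : ev (shift z F) t w = ev F t (w + z).
Proof. by rewrite /ev /shift horner_comp hornerD hornerX hornerC -polyCD. Qed.

Lemma at0_shift z F : at0 (shift z F) = at0 F \Po ('X + z%:P).
Proof.
by rewrite /at0 /shift map_comp_poly rmorphD /= map_polyX map_polyC /= /horner_eval hornerC.
Qed.

Lemma deriv_shift z F : (shift z F)^`() = shift z F^`().
Proof. by rewrite /shift deriv_comp derivD derivX derivC addr0 mulr1. Qed.

Lemma euler_shift z n F : euler n (shift z F) = shift z (euler n F).
Proof.
(* Additivity and commutation with scalars suffice, because the powers of ['X + z%:P%:P] have
   coefficients that are constant in [t]. *)
have lin f (E : {poly C} -> {poly C}) : E 0 = 0 ->
   (forall p q, E (p + q) = E p + E q) -> (forall p (c : C), E (p * c%:P) = E p * c%:P) ->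
   map_poly E (shift z f) = shift z (map_poly E f).
  move=> E0 ED EM; apply/polyP => j; rewrite coef_map_id0 // /shift.
  rewrite !coef_comp_poly.
  have sz : (size (map_poly E f) <= size f)%N by apply: size_poly.
  have -> : \sum_(i < size (map_poly E f)) (map_poly E f)`_i * (('X + z%:P%:P) ^+ i)`_j =
      \sum_(i < size f) (map_poly E f)`_i * (('X + z%:P%:P) ^+ i)`_j.
    rewrite -(big_mkord xpredT (fun i => (map_poly E f)`_i * (('X + z%:P%:P) ^+ i)`_j)).
    rewrite -[RHS](big_mkord xpredT (fun i => (map_poly E f)`_i * (('X + z%:P%:P) ^+ i)`_j)).
    rewrite [RHS](big_cat_nat (n := size (map_poly E f))) //=.
    rewrite [X in _ = _ + X]big1_seq ?addr0 // => i /andP [_].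
    by rewrite mem_index_iota => /andP [le _]; rewrite (nth_default 0 le) mul0r.
  have -> : forall I : seq 'I_(size f), E (\sum_(i <- I) f`_i * (('X + z%:P%:P) ^+ i)`_j) =
      \sum_(i <- I) E (f`_i * (('X + z%:P%:P) ^+ i)`_j).
    by elim=> [|i I IH]; rewrite ?big_nil // !big_cons ED IH.
  apply: eq_bigr => i _; rewrite coef_map_id0 //.
  have -> : 'X + z%:P%:P = map_poly polyC ('X + z%:P) :> {poly {poly C}}.
    by rewrite rmorphD /= map_polyX map_polyC.
  by rewrite -rmorphXn coef_map /= EM.
apply: lin => [|p q|p c].
- by rewrite linear0 mul0r mul0rn subr0.
- by rewrite derivD mulrDl mulrnDl; ring.
- by rewrite derivM derivC mulr0 addr0 mulrBl mulrnAl mulrAC.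
Qed.

Lemma wjac_shift z n m F G : wjac n m (shift z F) (shift z G) = shift z (wjac n m F G).
Proof.
rewrite /wjac !euler_shift !deriv_shift.
by rewrite /shift rmorphB !rmorphM.
Qed.

End WeightedJacobian.

(** * Proportional powers and Newton slopes *)

Section ProportionalPowers.
Variable C : numClosedFieldType.
Implicit Types p q : {poly C}.

Lemma lead_coef_deriv p : lead_coef p^`() = lead_coef p *+ (size p).-1.
Proof.
case: (ltnP 1 (size p)) => [sp|/size1_polyC ->]; last first.
  by rewrite derivC size_polyC lead_coef0; case: eqP.
have nz : (p^`())`_(size p).-2 != 0.
  rewrite coef_deriv -mulr_natr mulf_neq0 ?pnatr_eq0 //.
  have -> : (size p).-2.+1 = (size p).-1 by lia.
  by rewrite -lead_coefE lead_coef_eq0 -size_poly_gt0 ltnW.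
have sd : size p^`() = (size p).-1.
  apply/eqP; rewrite eqn_leq; apply/andP; split.
    by have := @lt_size_deriv _ p; rewrite -size_poly_gt0 => /(_ (ltnW sp)); lia.
  rewrite leqNgt; apply/negP => H; move: nz; rewrite nth_default ?eqxx //.
  by rewrite -ltnS (leq_trans H) // leqSpred.
rewrite lead_coefE sd coef_deriv; congr (_ *+ _); last lia.
by rewrite lead_coefE; congr (_`_ _); lia.
Qed.

(** The difference [h] of the two sides has smaller degree than [q] but still has zero Wronskian
    with [q]. If [h] were nonzero, comparing leading coefficients in characteristic 0 would give it
    the degree of [q]. *)
Lemma wronskian0_proportional p q : size p = size q ->
  p * q^`() = p^`() * q -> lead_coef q *: p = lead_coef p *: q.
Proof.
move=> spq W; apply/eqP; rewrite -subr_eq0; set h := _ - _.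
case: (posnP (size q)) => [sq0|sq].
  move: sq0 spq => /eqP; rewrite /h size_poly_eq0 => /eqP -> /eqP.
  by rewrite size_poly0 size_poly_eq0 => /eqP ->; rewrite !scaler0 subrr.
apply: contraT => h0.
have sh : (size h < size q)%N.
  rewrite -(prednK sq) ltnS; apply/leq_sizeP => j le.
  rewrite coefB !coefZ; move: le; rewrite leq_eqVlt => /orP [/eqP <-|lt].
    by rewrite lead_coefE lead_coefE spq mulrC subrr.
  have le : (size q <= j)%N by move: lt; case: (size q).
  by rewrite !nth_default ?spq // !mulr0 subrr.
have : h * q^`() = h^`() * q.
  rewrite /h derivB !derivZ !mulrBl -!scalerAl W; congr (_ - _ *: _).
  by rewrite mulrC.
move/(congr1 lead_coef); rewrite !lead_coefM !lead_coef_deriv mulrnAr mulrnAl.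
have nz : lead_coef h * lead_coef q != 0.
  by rewrite mulf_neq0 ?lead_coef_eq0 // -size_poly_gt0.
move/(mulrIn nz) => E.
have := h0; rewrite -size_poly_gt0; move: sh E.
by move: (size h) (size q) => a b; lia.
Qed.

Lemma mul_XsubC_exp_inj p q z i j : p.[z] != 0 -> q.[z] != 0 ->
  p * ('X - z%:P) ^+ i = q * ('X - z%:P) ^+ j -> i = j /\ p = q.
Proof.
wlog le : p q i j / (i <= j)%N.
  move=> H pz qz E; case/orP: (leq_total i j) => le; first exact: H.
  by case: (H q p j i le qz pz (esym E)) => -> ->.
move=> pz qz; rewrite -(subnK le) exprD mulrA.
have nz n : ('X - z%:P) ^+ n != 0 by rewrite expf_neq0 ?polyXsubC_eq0.
move/(mulIf (nz i)) => E.
have Eji : (j - i = 0)%N.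
  apply/eqP; rewrite -leqn0 leqNgt; apply/negP => ji.
  by rewrite E hornerM horner_exp hornerXsubC subrr expr0n gtn_eqF ?mulr0 ?eqxx // in pz.
by move: E; rewrite Eji expr0 mulr1; split => //; lia.
Qed.

Variables (d e : nat) (A B : C).
Hypotheses (d0 : (0 < d)%N) (e0 : (0 < e)%N) (cop : coprime d e).
Hypotheses (A0 : A != 0) (B0 : B != 0).

(** The identity d p q' = e p' q says that p^e and q^d, both of degree M d e, have zero Wronskian;
    the leading coefficients fix the factor. *)
Lemma proportional_powers M p q :
  size p = (M * d).+1 -> size q = (M * e).+1 ->
  lead_coef p ^+ e * B ^+ d = A ^+ e * lead_coef q ^+ d ->
  p * q^`() *+ d = p^`() * q *+ e ->
  B ^+ d *: p ^+ e = A ^+ e *: q ^+ d.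
Proof using d0 e0.
move=> sp sq L W.
have E : lead_coef (q ^+ d) *: p ^+ e = lead_coef (p ^+ e) *: q ^+ d.
  apply: wronskian0_proportional.
    have nzp : (0 < size (p ^+ e))%N by rewrite size_poly_gt0 expf_neq0 // -size_poly_gt0 sp.
    have nzq : (0 < size (q ^+ d))%N by rewrite size_poly_gt0 expf_neq0 // -size_poly_gt0 sq.
    have := size_exp p e; have := size_exp q d; rewrite sp sq /= => E1 E2.
    by rewrite -(prednK nzp) -(prednK nzq) E1 E2 mulnAC.
  have Ed : q ^+ d = q * q ^+ d.-1 by rewrite -exprS prednK.
  have Ee : p ^+ e = p * p ^+ e.-1 by rewrite -exprS prednK.
  rewrite !deriv_exp Ed Ee.
  transitivity (p ^+ e.-1 * q ^+ d.-1 * (p * q^`() *+ d)); first by ring.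
  by rewrite W; ring.
have nzq : lead_coef q ^+ d != 0 by rewrite expf_neq0 // lead_coef_eq0 -size_poly_gt0 sq.
apply: (scalerI nzq); move: E; rewrite !lead_coef_exp => E.
transitivity (B ^+ d *: (lead_coef q ^+ d *: p ^+ e)); first by rewrite !scalerA mulrC.
by rewrite E !scalerA [B ^+ d * _]mulrC L [A ^+ e * _]mulrC.
Qed.

(** Multiplicities m of p and n of q at z satisfy m e = n d, so coprimality makes them N d and N e.
    Cancelling the root factor and evaluating at z carries the normalisation over to the
    cofactors. *)
Lemma proportional_multiplicities M p q z :
  size p = (M * d).+1 -> size q = (M * e).+1 ->
  B ^+ d *: p ^+ e = A ^+ e *: q ^+ d -> root p z ->
  exists N p1 q1, [/\ (0 < N <= M)%N,
    p = p1 * ('X - z%:P) ^+ (N * d), q = q1 * ('X - z%:P) ^+ (N * e),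
    p1.[z] != 0 /\ q1.[z] != 0 &
    p1.[z] ^+ e * B ^+ d = A ^+ e * q1.[z] ^+ d].
Proof using d0 e0 cop A0 B0.
move=> sp sq E rz.
have p0 : p != 0 by rewrite -size_poly_gt0 sp.
have q0 : q != 0 by rewrite -size_poly_gt0 sq.
have [m [p1]] := multiplicity_XsubC p z; rewrite p0 /root /= => p1z Ep.
have [n [q1]] := multiplicity_XsubC q z; rewrite q0 /root /= => q1z Eq.
have : (B ^+ d *: p1 ^+ e) * ('X - z%:P) ^+ (m * e) =
       (A ^+ e *: q1 ^+ d) * ('X - z%:P) ^+ (n * d).
  by rewrite -!scalerAl !exprM -!exprMn -Ep -Eq.
case/(mul_XsubC_exp_inj).
- by rewrite hornerZ horner_exp mulf_neq0 ?expf_neq0.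
- by rewrite hornerZ horner_exp mulf_neq0 ?expf_neq0.
move=> Emn E1.
have dm : (d %| m)%N.
  by rewrite -(@Gauss_dvdl d m e) // Emn dvdn_mull.
pose N := (m %/ d)%N; have Em : m = (N * d)%N by rewrite divnK.
clearbody N.
have En : n = (N * e)%N.
  by apply/eqP; rewrite -(eqn_pmul2r d0) -Emn Em; apply/eqP; lia.
exists N, p1, q1; split => //; [apply/andP; split|by rewrite -Em|by rewrite -En|].
- case: (posnP N) => // N0; move: rz; rewrite /root Ep Em N0 mul0n expr0 mulr1.
  by rewrite (negPf p1z).
- have p10 : p1 != 0 by apply: contraNneq p1z => ->; rewrite horner0.
  have := sp; rewrite Ep size_proper_mul ?size_exp_XsubC ?Em; last first.
    by rewrite (monicP (monic_exp _ (monicXsubC z))) mulr1 lead_coef_eq0.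
  rewrite addnS /= => H; have : (0 < size p1)%N by rewrite size_poly_gt0.
  by move=> s1; rewrite -(leq_pmul2r d0); move: H s1; move: (size p1) => s; lia.
- have := congr1 (fun f => f.[z]) E1; rewrite !hornerZ !horner_exp => <-.
  by rewrite mulrC.
Qed.

End ProportionalPowers.

(** A pair holds a height and a horizontal distance; k/l is the smallest ratio height/distance in
    lowest terms, compared by cross-multiplication. *)
Lemma min_slope (s : seq (nat * nat)) : s != [::] ->
  {in s, forall vs, (0 < vs.1)%N && (0 < vs.2)%N} ->
  exists k l, [/\ (0 < k)%N, (0 < l)%N, coprime k l,
    {in s, forall vs, (k * vs.2 <= l * vs.1)%N} &
    exists2 vs, vs \in s & (k * vs.2 = l * vs.1)%N].
Proof.
move=> s0 pos.
have [[v0 s0'] /= m0 min0] : exists2 m, m \in s &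
    {in s, forall vs, (m.1 * vs.2 <= m.2 * vs.1)%N}.
  elim: s s0 pos => // a [|b s] IH _ pos.
    by exists a; rewrite ?inE // => x; rewrite inE => /eqP ->; rewrite mulnC.
  case: IH => // [x xs|m ms minm].
    by apply: pos; rewrite inE xs orbT.
  have pa := pos a (mem_head _ _).
  have pm : (0 < m.1)%N && (0 < m.2)%N by apply: pos; rewrite inE ms orbT.
  case: (leqP (m.1 * a.2)%N (m.2 * a.1)%N) => cmp.
    exists m; first by rewrite inE ms orbT.
    by move=> x; rewrite inE => /orP [/eqP ->|/minm].
  exists a; first exact: mem_head.
  move=> x; rewrite inE => /orP [/eqP ->|xs]; first by rewrite mulnC.
  have /andP [_ pm2] := pm; rewrite -(leq_pmul2l pm2).
  have le1 : (m.2 * a.1 * x.2 <= m.1 * a.2 * x.2)%N by rewrite leq_mul2r ltnW ?orbT.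
  have le2 : (a.2 * (m.1 * x.2) <= a.2 * (m.2 * x.1))%N by rewrite leq_mul2l minm ?orbT.
  by rewrite mulnA (leq_trans le1) // [(m.1 * _)%N]mulnC -mulnA (leq_trans le2) // mulnCA.
have /andP [/= pv ps] := pos _ m0.
pose g := gcdn v0 s0'; have g0 : (0 < g)%N by rewrite gcdn_gt0 pv.
have Ev : v0 = (v0 %/ g * g)%N by rewrite divnK // dvdn_gcdl.
have Es : s0' = (s0' %/ g * g)%N by rewrite divnK // dvdn_gcdr.
exists (v0 %/ g)%N, (s0' %/ g)%N; split.
- by rewrite divn_gt0 // dvdn_leq // dvdn_gcdl.
- by rewrite divn_gt0 // dvdn_leq // dvdn_gcdr.
- rewrite /coprime -(eqn_pmul2r g0) mul1n.
  by rewrite muln_gcdl -Ev -Es.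
- move=> x /min0 /= H; rewrite -(leq_pmul2r g0).
  by rewrite mulnAC -Ev [X in (_ <= X)%N]mulnAC -Es.
- exists (v0, s0') => //=; apply/eqP; rewrite -(eqn_pmul2r g0).
  by rewrite mulnAC -Ev [X in _ == X]mulnAC -Es mulnC.
Qed.

(** * Substitutions along a Newton slope *)

Section PullbackExistence.
Variable C : numClosedFieldType.
Implicit Types (c : {poly C}) (F : {poly {poly C}}).

(** The order of vanishing at 0; its value at the zero polynomial carries no meaning, so orders of
    coefficients are constrained under a nonvanishing guard. *)
Definition ord0p c : nat := sval (multiplicity_XsubC c 0).
Definition low c : {poly C} := c %/ 'X^(ord0p c).

Lemma low_ord c : c = low c * 'X^(ord0p c).
Proof.
rewrite /low divpK // /ord0p; case: multiplicity_XsubC => m /= [q _].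
by rewrite subr0 => ->; rewrite dvdp_mull.
Qed.

Lemma low_neq0 c : c != 0 -> (low c).[0] != 0.
Proof.
move=> c0; rewrite /low /ord0p; case: multiplicity_XsubC => m /= [q].
by rewrite c0 subr0 /= /root => q0 {1}->; rewrite mulpK // expf_neq0 ?polyX_eq0.
Qed.

Lemma ord0p_eq0 c : c.[0] != 0 -> ord0p c = 0%N.
Proof.
case E : (ord0p c) => [//|n]; rewrite [c]low_ord E hornerM hornerXn expr0n mulr0.
by rewrite eqxx.
Qed.

Lemma ord0p_gt0 c : c != 0 -> c.[0] = 0 -> (0 < ord0p c)%N.
Proof.
move=> c0; rewrite lt0n; apply: contra_eqN => /eqP E.
by rewrite [c]low_ord E expr0 mulr1; exact: low_neq0.
Qed.

(** Every monomial has weight at least [N], so t^N divides F(t^l, t^k w). At t = 0 exactly the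
    lowest terms lying on the Newton line of weight [N] survive. *)
Lemma pullback_exists k l N F : (0 < l)%N ->
  (forall j, F`_j != 0 -> (N <= l * ord0p F`_j + k * j)%N) ->
  exists F', [/\ weighted_pullback k l N F F',
    forall j, F`_j != 0 -> (N = l * ord0p F`_j + k * j)%N -> (F'`_j).[0] = (low F`_j).[0] &
    forall j, (F'`_j).[0] != 0 -> F`_j != 0 /\ (N = l * ord0p F`_j + k * j)%N].
Proof.
move=> l0 H.
pose f j := (low F`_j \Po 'X^l) * 'X^(l * ord0p F`_j + k * j - N).
exists (\poly_(j < size F) f j).
have low0 : low 0 = 0 by rewrite /low div0p.
have co j : (\poly_(j < size F) f j)`_j = f j.
  rewrite coef_poly; case: ltnP => // le.
  by rewrite /f (nth_default 0 le) low0 comp_poly0 mul0r.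
split=> j; rewrite co /f.
- have [->|nz] := eqVneq (F`_j) 0.
    by rewrite low0 !comp_poly0 !mul0r.
  rewrite -mulrA -exprD subnK ?H // exprD mulrA; congr (_ * _).
  by rewrite {3}[F`_j]low_ord comp_polyM comp_Xn_poly -exprM.
- move=> nz ->; rewrite subnn expr0 mulr1 horner_comp hornerXn expr0n.
  by rewrite gtn_eqF.
- have [->|nz] := eqVneq (F`_j) 0.
    by rewrite low0 !comp_poly0 !mul0r horner0 eqxx.
  rewrite hornerM hornerXn expr0n mulf_eq0 negb_or => /andP [_].
  rewrite pnatr_eq0 eqb0 negbK subn_eq0 => le.
  by split => //; apply/eqP; rewrite eqn_leq H.
Qed.

End PullbackExistence.

(** * Coordinates at infinity *)

Section Homogenization.
Variable C : numClosedFieldType.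
Implicit Types (a : {poly C}) (P Q F : {poly {poly C}}).

(** The reversal t^N a(1/t), for [a] of degree at most [N]. *)
Definition revp N a : {poly C} := \poly_(i < N.+1) a`_(N - i).

Lemma horner_revp N a t : (size a <= N.+1)%N -> t != 0 ->
  (revp N a).[t] = t ^+ N * a.[t^-1].
Proof.
move=> sa t0; rewrite horner_poly (horner_coef_wide _ sa) mulr_sumr.
rewrite (reindex_inj rev_ord_inj) /=; apply: eq_bigr => i _.
have le : (i <= N)%N by rewrite -ltnS.
rewrite subSS subKn // mulrCA; congr (_ * _).
have -> : t ^+ N = t ^+ (N - i) * t ^+ i by rewrite -exprD subnK.
by rewrite exprVn mulfK // expf_neq0.
Qed.

Lemma deriv_revp N a t : (size a <= N.+1)%N -> t != 0 ->
  (revp N a)^`().[t] * t = t ^+ N * (a.[t^-1] *+ N - a^`().[t^-1] * t^-1).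
Proof.
move=> sa t0.
have E : (revp N a)^`() * 'X = revp N (a *+ N - a^`() * 'X).
  apply/polyP => i; rewrite coefMX coef_deriv !coef_poly coefB coefMn coefMX coef_deriv.
  case: i => [|i] /=.
    by rewrite subn0; case: N sa => [|N] _; rewrite ?mulr0n ?subrr.
  rewrite ltnS; case: ltnP => le; last by rewrite mul0rn.
  case: eqP => [E|/eqP E].
    by rewrite subr0; congr (_ *+ _); lia.
  rewrite prednK ?lt0n // -mulrnBr; last lia.
  by congr (_ *+ _); lia.
have := congr1 (fun p => p.[t]) E; rewrite hornerM hornerX => ->.
rewrite horner_revp //; first by rewrite hornerD hornerN hornerMn hornerM hornerX.
apply/leq_sizeP => i le; rewrite coefB coefMn coefMX coef_deriv.
rewrite nth_default ?(leq_trans sa) // mul0rn sub0r.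
by case: i le => // i le; rewrite /= nth_default ?mul0rn ?oppr0 // (leq_trans sa).
Qed.

(** For [P] of total degree at most [n] this is t^n P(1/t, w/t). *)
Definition homog n P : {poly {poly C}} := \poly_(j < n.+1) revp (n - j) P`_j.

Section Facts.
Variables (n : nat) (P : {poly {poly C}}).
Hypotheses (sP : (size P <= n.+1)%N)
  (sPj : forall j, (j <= n)%N -> (size (P`_j)%R <= (n - j).+1)%N).

Let coefP j : (n < j)%N -> P`_j = 0.
Proof. by move=> lt; rewrite nth_default // (leq_trans sP). Qed.

Let revpF j t : (j <= n)%N -> t != 0 ->
  (revp (n - j) P`_j).[t] * t^-1 ^+ n = (P`_j).[t^-1] * t^-1 ^+ j.
Proof.
move=> le t0; rewrite horner_revp ?sPj // -{2}(subnK le) exprD !exprVn.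
by field; rewrite !expf_neq0.
Qed.

Lemma homog_ev t w : t != 0 ->
  ev (homog n P) t w * t^-1 ^+ n = ev P t^-1 (t^-1 * w).
Proof.
move=> t0; rewrite -[RHS]mul1r; apply: ev_transfer => j; rewrite mul1r coef_poly ltnS.
by case: leqP => [/revpF ->//|/coefP ->]; rewrite !horner0 !mul0r.
Qed.

Lemma homog_deriv t w : t != 0 ->
  ev (homog n P)^`() t w * t^-1 ^+ n = t^-1 * ev P^`() t^-1 (t^-1 * w).
Proof.
move=> t0; apply: ev_transfer => j; rewrite !coef_deriv coef_poly ltnS !hornerMn.
case: (leqP j.+1 n) => [le|/coefP ->]; first have H := revpF le t0.
  by rewrite mulrnAl H exprS mulrCA -mulrnAr mulrnAl.
by rewrite !horner0 mul0rn !mul0r mulr0.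
Qed.

(** The subtracted [n] removes the derivative of t^n, and t d/dt of P(1/t, w/t) is -(x P_x + y P_y)
    at x = 1/t, y = w/t. *)
Lemma homog_euler t w : t != 0 ->
  ev (euler n (homog n P)) t w * t^-1 ^+ n =
    - (t^-1 * ev (map_poly (@deriv C) P) t^-1 (t^-1 * w)
       + t^-1 * w * ev P^`() t^-1 (t^-1 * w)).
Proof.
move=> t0.
have -> : forall s y, - (s * ev (map_poly (@deriv C) P) s y + y * ev P^`() s y)
    = - 1 * ev ('X%:P * map_poly (@deriv C) P + 'X * P^`()) s y.
  by move=> s y; rewrite !evE hornerX mulN1r.
apply: ev_transfer => j; rewrite coef_euler coefD coefCM coef_map /= coefXM coef_deriv.
have -> : (if j == 0%N then 0 else P`_j.-1.+1 *+ j.-1.+1) = P`_j *+ j.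
  by case: j.
rewrite /homog coef_poly ltnS; case: leqP => [le|/coefP ->]; last first.
  by rewrite !derivC !mul0r !mul0rn mulr0 subrr addr0 !horner0 !mul0r mulr0.
rewrite hornerD hornerN hornerMn !hornerM hornerX deriv_revp ?sPj //.
rewrite horner_revp ?sPj // !(hornerD, hornerM, hornerMn, hornerX).
rewrite -{4}(subnK le) mulrnDr.
have -> : t^-1 ^+ n = t^-1 ^+ j * t^-1 ^+ (n - j) by rewrite -exprD subnKC.
have tt : t ^+ (n - j) * t^-1 ^+ (n - j) = 1.
  by rewrite -exprMn divff // expr1n.
set x := (P`_j)^`().[_]; set y := (P`_j).[_].
transitivity ((t ^+ (n - j) * t^-1 ^+ (n - j)) * t^-1 ^+ j * (- (t^-1 * x + y *+ j))).
  ring.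
by rewrite tt; ring.
Qed.

End Facts.

(** The map (t, w) -> (1/t, w/t) has Jacobian -t^-3, so the weighted Jacobian is -c t^(n+m-2); it is
    multiplied by t^2 to avoid a negative exponent. *)
Lemma wjac_homog n m P Q c :
  (size P <= n.+1)%N -> (forall j, (j <= n)%N -> (size (P`_j)%R <= (n - j).+1)%N) ->
  (size Q <= m.+1)%N -> (forall j, (j <= m)%N -> (size (Q`_j)%R <= (m - j).+1)%N) ->
  map_poly (@deriv C) P * Q^`() - P^`() * map_poly (@deriv C) Q = c%:P%:P -> c != 0 ->
  exists k, wjac n m (homog n P) (homog m Q) = (- c *: 'X^k)%:P.
Proof.
move=> sP sPj sQ sQj J c0; apply: (@mulXn_monomial2 _ _ 2 (n + m)); first by rewrite oppr_eq0.
apply: ev_inj_off0 => t w t0; rewrite evE /wjac !evE hornerZ !hornerXn.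
have nz : t^-1 ^+ n * t^-1 ^+ m != 0 by rewrite mulf_neq0 // expf_neq0 // invr_eq0.
apply: (mulIf nz).
have tt k : t ^+ k * t^-1 ^+ k = 1 by rewrite -exprMn divff // expr1n.
have -> : - c * t ^+ (n + m) * (t^-1 ^+ n * t^-1 ^+ m) = - c * (t ^+ n * t^-1 ^+ n) * (t ^+ m * t^-1 ^+ m).
  by rewrite exprD; ring.
rewrite !tt !mulr1.
have -> : forall x y z u r s v : C, (x * y + - (z * u)) * v * (s * r) =
   ((x * s) * (y * r) - (z * s) * (u * r)) * v by move=> *; ring.
rewrite homog_euler // homog_euler // homog_deriv // homog_deriv //.
have := congr1 (fun H => ev H t^-1 (t^-1 * w)) J; rewrite !evE hornerC => <-.
have := tt 2%N; set s := t^-1 => ss.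
rewrite -[RHS]mulr1 -ss; ring.
Qed.

End Homogenization.

(** * Cluster values *)

Section Estimates.
Variable C : numClosedFieldType.
Implicit Types (p q : {poly C}) (F G : {poly {poly C}}) (t w u v x y z K W : C).

(** The order on [C] is partial, but positive elements are real and hence comparable. *)
Lemma pos_min x y : 0 < x -> 0 < y -> exists m, [/\ 0 < m, m <= x & m <= y].
Proof.
move=> x0 y0; have [le|lt] := real_leP (gtr0_real x0) (gtr0_real y0).
  by exists x.
by exists y; split=> //; exact: ltW.
Qed.

Lemma pos_small x y : 0 < x -> 0 <= y -> exists m, [/\ 0 < m, m <= 1, m <= x & y * m < x].
Proof.
move=> x0 y0; have y1 : 0 < y + 1 by rewrite ltr_wpDl.
have [m [m0 mx m1]] := @pos_min (x / (y + 1)) 1 (divr_gt0 x0 y1) ltr01.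
have [m' [m'0 m'm m'x]] := pos_min m0 x0.
exists m'; split => //; first exact: le_trans m1.
have : m' * (y + 1) <= x by rewrite -ler_pdivlMr // (le_trans m'm).
by apply: lt_le_trans; rewrite mulrDr mulr1 mulrC ltrDl.
Qed.

Lemma norm_eq0_small x y : 0 <= y ->
  (forall m, 0 < m -> m <= 1 -> `|x| <= y * m) -> x = 0.
Proof.
move=> y0 H; apply/eqP/contraT; rewrite -normr_gt0 => x0.
have [m [m0 m1 _]] := pos_small x0 y0.
by move/(le_lt_trans (H m m0 m1)); rewrite ltxx.
Qed.

(** If every index failed at some accuracy, all would fail at the smallest of these finitely many.
    This replaces the extraction of a convergent subsequence. *)
Lemma pigeonhole (T : eqType) (s : seq T) (Pr : T -> C -> Prop) :
  (forall i x y, x <= y -> Pr i x -> Pr i y) ->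
  (forall x, 0 < x -> exists2 i, i \in s & Pr i x) ->
  exists2 i, i \in s & forall x, 0 < x -> Pr i x.
Proof.
move=> mono; elim: s => [|i s IH] H; first by case: (H 1 ltr01).
have [all_i|/existsNP [x0 /not_implyP [x0p nP]]] := pselect (forall x, 0 < x -> Pr i x).
  by exists i; rewrite ?mem_head.
case: IH => [x xp|j js Hj]; last by exists j => //; rewrite inE js orbT.
have [m [m0 mx mx0]] := pos_min xp x0p.
case: (H m m0) => j; rewrite inE => /orP [/eqP ->|js] Pj.
  by case: nP; apply: mono Pj.
by exists j => //; apply: mono Pj.
Qed.

Lemma poly_bounded p W : 0 <= W ->
  exists2 K, 0 <= K & forall w, `|w| <= W -> `|p.[w]| <= K.
Proof.
move=> W0; elim/poly_ind: p => [|p c [K K0 H]].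
  by exists 0 => // w _; rewrite horner0 normr0.
exists (K * W + `|c|); first by rewrite addr_ge0 // mulr_ge0.
move=> w wW; rewrite hornerMXaddC (le_trans (ler_normD _ _)) // lerD2r normrM.
by rewrite ler_pM // H.
Qed.

Lemma poly_lipschitz p z :
  exists2 K, 0 <= K & forall w, `|w - z| <= 1 -> `|p.[w] - p.[z]| <= K * `|w - z|.
Proof.
have /factor_theorem [r Er] : root (p - p.[z]%:P) z.
  by rewrite /root hornerD hornerN hornerC subrr.
have [K K0 H] := @poly_bounded r (1 + `|z|) (addr_ge0 ler01 (normr_ge0 _)).
exists K => // w wz.
have := congr1 (fun f => f.[w]) Er; rewrite hornerD hornerN hornerC hornerM hornerXsubC => ->.
rewrite normrM ler_wpM2r // H //.
by rewrite -[w](subrK z) (le_trans (ler_normD _ _)) // lerD2r.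
Qed.

Lemma ev_lipschitz0 F W : 0 <= W ->
  exists2 K, 0 <= K & forall t w, `|t| <= 1 -> `|w| <= W ->
    `|ev F t w - ev F 0 w| <= K * `|t|.
Proof.
move=> W0; elim/poly_ind: F => [|F c [K K0 H]].
  by exists 0 => // t w _ _; rewrite /ev !horner0 subrr normr0 mul0r.
have [L L0 HL] := poly_lipschitz c 0.
exists (K * W + L); first by rewrite addr_ge0 // mulr_ge0.
move=> t w t1 wW; rewrite !evE.
have -> : ev F t w * w + c.[t] - (ev F 0 w * w + c.[0]) =
  (ev F t w - ev F 0 w) * w + (c.[t] - c.[0]) by ring.
rewrite (le_trans (ler_normD _ _)) // [(_ + L) * _]mulrDl lerD //; last first.
  by have := HL t; rewrite subr0; apply.
by rewrite normrM mulrAC ler_pM // H.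
Qed.

Lemma sum_growth F T n : 0 <= T ->
  exists2 K, 0 <= K & forall t w, `|t| <= T -> 1 <= `|w| ->
    `|\sum_(j < n) (F`_j).[t] * w ^+ j| <= K * `|w| ^+ n.-1.
Proof.
move=> T0; elim: n => [|n [K K0 H]].
  by exists 0 => // t w _ _; rewrite big_ord0 normr0 mul0r.
have [L L0 HL] := poly_bounded F`_n T0.
exists (K + L); first exact: addr_ge0.
move=> t w tT w1; rewrite big_ord_recr /= (le_trans (ler_normD _ _)) // mulrDl lerD //.
  by rewrite (le_trans (H t w tT w1)) // ler_wpM2l // ler_weXn2l // leq_pred.
by rewrite normrM normrX ler_wpM2r ?exprn_ge0 // HL.
Qed.

Lemma ev_take_drop n F t w :
  ev F t w = \sum_(j < n) (F`_j).[t] * w ^+ j + ev (drop_poly n F) t w * w ^+ n.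
Proof.
rewrite -{1}(poly_take_drop n F) !evE (@ev_coef _ (take_poly n F) _ _ n) ?size_take_poly //.
by congr (_ + _); apply: eq_bigr => j _; rewrite coef_take_poly ltn_ord.
Qed.

(** For |w| > 1 the part of degree at least [n] has modulus at least r |w|^n, while the lower terms
    and the bound on F are O(|w|^(n-1)). *)
Lemma bounded_of_leading F n T r K : (0 < n)%N -> 0 <= T -> 0 < r -> 0 <= K ->
  exists2 W, 0 <= W & forall t w, `|t| <= T -> r <= `|ev (drop_poly n F) t w| ->
    `|ev F t w| <= K -> `|w| <= W.
Proof.
move=> n0 T0 r0 K0; have [L L0 HL] := sum_growth F n T0.
have KL : 0 <= (K + L) / r by rewrite divr_ge0 ?addr_ge0 // ltW.
exists (1 + (K + L) / r); first by rewrite addr_ge0.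
move=> t w tT rd Fb.
have [w1|w1] := real_leP (normr_real w) (@real1 C).
  by rewrite (le_trans w1) // lerDl.
suff le : `|w| <= (K + L) / r by rewrite (le_trans le) // lerDr.
rewrite ler_pdivlMr //.
have wn : 0 < `|w| ^+ n.-1 by rewrite exprn_gt0 // (lt_trans ltr01).
rewrite -(ler_pM2r wn).
have -> : `|w| * r * `|w| ^+ n.-1 = r * `|w| ^+ n by rewrite -{2}(prednK n0) exprS; ring.
have le1 : r * `|w| ^+ n <= `|ev (drop_poly n F) t w * w ^+ n|.
  by rewrite normrM normrX ler_wpM2r ?exprn_ge0.
apply: (le_trans le1).
have -> : ev (drop_poly n F) t w * w ^+ n =
  ev F t w - \sum_(j < n) (F`_j).[t] * w ^+ j by rewrite (ev_take_drop n F); ring.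
rewrite (le_trans (ler_normB _ _)) // mulrDl lerD //; last by rewrite HL // ltW.
by rewrite (le_trans Fb) // ler_peMr // exprn_ege1 // ltW.
Qed.

(** |p(w)| is |lead p| times the product of the distances to the roots, so a small value forces a
    small distance. *)
Lemma near_roots p : p != 0 -> exists2 rs : seq C, {in rs, forall z, root p z} &
  forall x, 0 < x -> exists2 y, 0 < y & forall w, `|p.[w]| < y ->
    exists2 z, z \in rs & `|w - z| < x.
Proof.
move=> p0; have [rs E] := closed_field_poly_normal p; exists rs => [z zs|x x0].
  by rewrite E rootZ ?lead_coef_eq0 // root_prod_XsubC.
exists (`|lead_coef p| * x ^+ size rs); first by rewrite mulr_gt0 ?normr_gt0 ?lead_coef_eq0 ?exprn_gt0.
move=> w; rewrite {1}E hornerZ normrM ltr_pM2l ?normr_gt0 ?lead_coef_eq0 // => lt.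
have [/hasP [z zs wz]|/hasPn far] := boolP (has (fun z => `|w - z| < x) rs); first by exists z.
move: lt; rewrite real_ltNge ?normr_real ?gtr0_real ?exprn_gt0 // => /negP; case.
elim: rs far {E} => [|z rs IH] far; first by rewrite big_nil hornerC normr1.
rewrite big_cons hornerM normrM hornerXsubC exprS ler_pM ?exprn_ge0 ?(ltW x0) //.
  by rewrite real_leNgt ?normr_real ?gtr0_real ?far ?mem_head.
by apply: IH => y ys; rewrite far // inE ys orbT.
Qed.

End Estimates.

(** * Limit sets and their behaviour under substitutions *)

Section LimitSets.
Variable C : numClosedFieldType.
Implicit Types (F G P Q : {poly {poly C}}) (t w u v x y z K W : C).

Definition near a b F G u v x t w := [/\ t != 0, `|t| < x,
  `|ev F t w / t ^+ a - u| < x & `|ev G t w / t ^+ b - v| < x].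

(* (u, v) is a cluster value of (F / t^a, G / t^b) as (t, w) tends to (0, z). *)
Definition limit_at a b F G z u v := forall x, 0 < x ->
  exists t w, near a b F G u v x t w /\ `|w - z| < x.

(** Cluster values along bounded [w]: the radius [W] is chosen before the accuracy [x]. *)
Definition limit_bd a b F G u v := exists2 W, 0 <= W & forall x, 0 < x ->
  exists t w, near a b F G u v x t w /\ `|w| <= W.

Lemma near_le a b F G u v x y t w : x <= y -> near a b F G u v x t w -> near a b F G u v y t w.
Proof. by move=> le [t0 tx Fx Gx]; split=> //; apply: lt_le_trans le. Qed.

Lemma limit_at_bd a b F G z u v : limit_at a b F G z u v -> limit_bd a b F G u v.
Proof.
move=> H; exists (1 + `|z|); first by rewrite addr_ge0.
move=> x x0; have [m [m0 mx m1]] := pos_min x0 ltr01.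
have [t [w [nr wz]]] := H m m0; exists t, w; split; first exact: near_le nr.
by rewrite -[w](subrK z) (le_trans (ler_normD _ _)) // lerD2r ltW // (lt_le_trans wz).
Qed.

Lemma limit_at_shift a b F G z u v :
  limit_at a b (shift z F) (shift z G) 0 u v <-> limit_at a b F G z u v.
Proof.
split=> H x x0; have [t [w [nr wx]]] := H x x0.
  exists t, (w + z); split; last by rewrite addrK -[w]subr0.
  by move: nr; rewrite /near !ev_shift.
exists t, (w - z); split; last by rewrite subr0.
by rewrite /near !ev_shift subrK.
Qed.

Lemma ratio_bound a F u t w : t != 0 -> `|t| <= 1 -> `|ev F t w / t ^+ a - u| <= 1 ->
  `|ev F t w| <= (1 + `|u|) * `|t| ^+ a.
Proof.
move=> t0 t1 H; rewrite -ler_pdivrMr ?exprn_gt0 ?normr_gt0 // -normrX -normfV -normrM.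
by rewrite -[_ / _](subrK u) (le_trans (ler_normD _ _)) // lerD2r.
Qed.

(** A bounded ratio with positive pole order gives F(t, w) = O(t), and F(0, w) differs from F(t, w)
    by O(t). *)
Lemma at0_small a F u W : (0 < a)%N -> 0 <= W -> exists2 K, 0 <= K &
  forall t w, t != 0 -> `|t| <= 1 -> `|w| <= W -> `|ev F t w / t ^+ a - u| <= 1 ->
  `|(at0 F).[w]| <= K * `|t|.
Proof.
move=> a0 W0; have [K K0 H] := ev_lipschitz0 F W0.
exists (1 + `|u| + K); first by rewrite !addr_ge0.
move=> t w t0 t1 wW nr.
have -> : (at0 F).[w] = ev F t w - (ev F t w - ev F 0 w) by rewrite at0E subKr.
rewrite (le_trans (ler_normB _ _)) // mulrDl lerD ?H //.
rewrite (le_trans (ratio_bound t0 t1 nr)) // ler_wpM2l ?addr_ge0 //.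
by rewrite -{2}[`|t|]expr1 ler_wiXn2l.
Qed.

Lemma limit_at_root a b F G z u v : (0 < a)%N -> limit_at a b F G z u v -> root (at0 F) z.
Proof.
move=> a0 H; apply/eqP.
have [L L0 HL] := poly_lipschitz (at0 F) z.
have [K K0 HK] := @at0_small a F u (1 + `|z|) a0 (addr_ge0 ler01 (normr_ge0 _)).
apply: (@norm_eq0_small _ _ (K + L)); first exact: addr_ge0.
move=> m m0 m1; have [t [w [[t0 tm Fm _] wz]]] := H m m0.
have wz1 : `|w - z| <= 1 by rewrite ltW // (lt_le_trans wz).
rewrite -[_.[z]](subKr (at0 F).[w]) (le_trans (ler_normB _ _)) // mulrDl lerD //.
  rewrite (le_trans (HK t w _ _ _ _)) //.
  - by rewrite ltW // (lt_le_trans tm).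
  - by rewrite -[w](subrK z) (le_trans (ler_normD _ _)) // lerD2r.
  - by rewrite ltW // (lt_le_trans Fm).
  - by rewrite ler_wpM2l // ltW.
by rewrite (le_trans (HL w wz1)) // ler_wpM2l // ltW.
Qed.

Lemma near_swap a b F G u v x t w : near a b F G u v x t w -> near b a G F v u x t w.
Proof. by case. Qed.

Lemma limit_at_swap a b F G z u v : limit_at a b F G z u v -> limit_at b a G F z v u.
Proof.
move=> H x /H [t [w [nr wz]]]; exists t, w; split=> //; exact: near_swap.
Qed.

(** F(0, w) tends to 0, so [w] approaches the finite root set of [at0 F], and [pigeonhole] fixes one
    root. Exchanging [F] and [G] shows that [at0 G] vanishes there too. *)
Lemma limit_bd_node a b F G u v : (0 < a)%N -> (0 < b)%N -> at0 F != 0 ->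
  limit_bd a b F G u v <->
  exists z, [/\ root (at0 F) z, root (at0 G) z & limit_at a b F G z u v].
Proof.
move=> a0 b0 F0; split=> [[W W0 H]|[z [_ _ Hz]]]; last exact: limit_at_bd Hz.
have [rs rsr near_rs] := near_roots F0.
have [K K0 HK] := @at0_small a F u W a0 W0.
case: (@pigeonhole C _ rs (fun z x => exists t w, near a b F G u v x t w /\ `|w - z| < x)).
- move=> z x y le [t [w [nr wz]]]; exists t, w; split; first exact: near_le nr.
  exact: lt_le_trans le.
- move=> x x0; have [y y0 Hy] := near_rs x x0.
  have [m [m0 m1 my Km]] := pos_small y0 K0; have [m' [m'0 m'm m'x]] := pos_min m0 x0.
  have [t [w [nr wW]]] := H m' m'0.
  have [t0 tm Fm _] := nr.
  have [|z zs wz] := Hy w.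
    rewrite (le_lt_trans (HK t w _ _ _ _)) //.
    + by rewrite ltW // (lt_le_trans tm) // (le_trans m'm).
    + by rewrite ltW // (lt_le_trans Fm) // (le_trans m'm).
    + by rewrite (le_lt_trans _ Km) // ler_wpM2l // ltW // (lt_le_trans tm).
  by exists z => //; exists t, w; split => //; apply: near_le nr.
- move=> z zs Hz; exists z; split=> //; first exact: rsr.
  exact: limit_at_root (limit_at_swap Hz).
Qed.

(** Without poles, F(0, w) tends to [u], so [w] approaches one of the finitely many roots of
    [at0 F - u%:P], which is nonzero since [at0 F] is not constant. Continuity of [at0 G] then
    identifies [v]. *)
Lemma limit_bd_leaf F G u v : (1 < size (at0 F))%N ->
  limit_bd 0 0 F G u v <-> exists xi, u = (at0 F).[xi] /\ v = (at0 G).[xi].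
Proof.
move=> sF; split=> [[W W0 H]|[xi [-> ->]]]; last first.
  exists `|xi| => // x x0.
  have [K K0 HK] := ev_lipschitz0 F (normr_ge0 xi).
  have [L L0 HL] := ev_lipschitz0 G (normr_ge0 xi).
  have [m [m0 m1 mx KLm]] := pos_small x0 (addr_ge0 K0 L0).
  have [m' [m'0 _ _ m'm]] := pos_small m0 ler01; rewrite mul1r in m'm.
  have nm : `|m'| = m' by rewrite gtr0_norm.
  have m'1 : `|m'| <= 1 by rewrite nm (le_trans (ltW m'm)).
  exists m', xi; split => //; split; rewrite ?nm ?gt_eqF //.
  - exact: lt_le_trans mx.
  - rewrite expr0 divr1 at0E (le_lt_trans (HK _ _ m'1 _)) // nm.
    rewrite (le_lt_trans _ KLm) // (le_trans (ler_wpM2l K0 (ltW m'm))) //.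
    by rewrite ler_wpM2r ?(ltW m0) // lerDl.
  - rewrite expr0 divr1 at0E (le_lt_trans (HL _ _ m'1 _)) // nm.
    rewrite (le_lt_trans _ KLm) // (le_trans (ler_wpM2l L0 (ltW m'm))) //.
    by rewrite ler_wpM2r ?(ltW m0) // lerDr.
have p0 : at0 F - u%:P != 0.
  apply: contraTneq sF => /eqP; rewrite subr_eq0 => /eqP ->.
  by rewrite -leqNgt size_polyC_leq1.
have [rs rsr near_rs] := near_roots p0.
have [K K0 HK] := ev_lipschitz0 F W0.
have [L L0 HL] := ev_lipschitz0 G W0.
case: (@pigeonhole C _ rs (fun z x => exists w, `|w - z| < x /\ `|(at0 G).[w] - v| < x)).
- by move=> z x y le [w [w1 w2]]; exists w; split; apply: lt_le_trans le.
- move=> x x0; have [y y0 Hy] := near_rs x x0.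
  have [m [m0 m1 my Km]] := pos_small y0 (addr_ge0 K0 ler01).
  have [m' [m'0 m'1 m'x Lm']] := pos_small x0 (addr_ge0 L0 ler01).
  have [r [r0 rm rm']] := pos_min m0 m'0.
  have [t [w [[t0 tr Fr Gr] wW]]] := H r r0.
  rewrite !expr0 !divr1 in Fr Gr.
  have t1 : `|t| <= 1 by rewrite ltW // (lt_le_trans tr) // (le_trans rm).
  have [|z zs wz] := Hy w.
    rewrite hornerD hornerN hornerC at0E.
    have -> : ev F 0 w - u = (ev F t w - u) - (ev F t w - ev F 0 w) by ring.
    rewrite (le_lt_trans (ler_normB _ _)) // (le_lt_trans _ Km) // mulrDl mul1r addrC lerD //.
      by rewrite (le_trans (HK _ _ t1 wW)) // ler_wpM2l // ltW // (lt_le_trans tr).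
    by rewrite ltW // (lt_le_trans Fr).
  exists z => //; exists w; split => //.
  rewrite at0E.
  have -> : ev G 0 w - v = (ev G t w - v) - (ev G t w - ev G 0 w) by ring.
  rewrite (le_lt_trans (ler_normB _ _)) // (le_lt_trans _ Lm') // mulrDl mul1r addrC lerD //.
    by rewrite (le_trans (HL _ _ t1 wW)) // ler_wpM2l // ltW // (lt_le_trans tr).
  by rewrite ltW // (lt_le_trans Gr).
- move=> z /rsr; rewrite /root hornerD hornerN hornerC subr_eq0 => /eqP Ez Hz.
  exists z; split=> //.
  have [D D0 HD] := poly_lipschitz (at0 G) z.
  apply/eqP; rewrite -subr_eq0; apply/eqP.
  apply: (@norm_eq0_small _ _ (1 + D)); first by rewrite addr_ge0.
  move=> m m0 m1; have [w [wz Gw]] := Hz m m0.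
  have wz1 : `|w - z| <= 1 by rewrite ltW // (lt_le_trans wz).
  have -> : v - (at0 G).[z] = ((at0 G).[w] - (at0 G).[z]) - ((at0 G).[w] - v) by ring.
  rewrite (le_trans (ler_normB _ _)) // mulrDl mul1r addrC lerD //; first exact: ltW.
  by rewrite (le_trans (HD w wz1)) // ler_wpM2l // ltW.
Qed.

Lemma pullback_ratio k l N a a' F F' t w : weighted_pullback k l N F F' ->
  (a' + N = l * a)%N -> t != 0 ->
  ev F' t w / t ^+ a' = ev F (t ^+ l) (t ^+ k * w) / (t ^+ l) ^+ a.
Proof.
move=> pb E t0; rewrite -(pullback_ev _ _ pb) -exprM -E exprD.
by rewrite -mulf_div divff ?mulr1 // expf_neq0.
Qed.

Lemma drop_pullback k l n F F' : weighted_pullback k l (k * n) F F' ->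
  weighted_pullback k l 0 (drop_poly n F) (drop_poly n F').
Proof.
move=> pb j; rewrite !coef_drop_poly expr0 mulr1.
apply: (@mulIf _ 'X^(k * n)); first by rewrite expf_neq0 ?polyX_eq0.
by rewrite pb mulnDr exprD mulrA.
Qed.

(** Forward, the new parameter is an l-th root of the old one, and w / t^k stays bounded because the
    coefficient of w^n does not vanish at t = 0. Backward, t^k w tends to 0 for bounded w. *)
Lemma limit_pullback k l n N' a a' b b' F F' G G' u v :
  (0 < k)%N -> (0 < l)%N -> (0 < n)%N -> (F`_n).[0] != 0 ->
  weighted_pullback k l (k * n) F F' -> weighted_pullback k l N' G G' ->
  (a' + k * n = l * a)%N -> (b' + N' = l * b)%N ->
  limit_at a b F G 0 u v <-> limit_bd a' b' F' G' u v.
Proof.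
move=> k0 l0 n0 Fn pbF pbG Ea Eb; split=> [H|[W W0 H]]; last first.
  move=> x x0; have [m [m0 m1 mx Wm]] := pos_small x0 W0.
  have [t [w [[t0 tm Fm Gm] wW]]] := H m m0.
  rewrite (pullback_ratio _ pbF Ea t0) in Fm; rewrite (pullback_ratio _ pbG Eb t0) in Gm.
  have t1 : `|t| <= 1 by rewrite ltW // (lt_le_trans tm).
  have tle i : (0 < i)%N -> `|t ^+ i| <= `|t|.
    by move=> i0; rewrite normrX -{2}[`|t|]expr1 ler_wiXn2l.
  exists (t ^+ l), (t ^+ k * w); split; first split.
  - by rewrite expf_neq0.
  - by rewrite (le_lt_trans (tle l l0)) // (lt_le_trans tm).
  - exact: lt_le_trans mx.
  - exact: lt_le_trans mx.
  - rewrite subr0 normrM (le_lt_trans _ Wm) // mulrC ler_pM //.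
    by rewrite (le_trans (tle k k0)) // ltW.
(* Near the origin the part of degree at least [n], divided by w^n, stays within [r] of its value
   there, hence has modulus at least [r]. *)
pose r := `|(F`_n).[0]| / 2%:R.
have r0 : 0 < r by rewrite divr_gt0 ?normr_gt0 ?ltr0n.
have [W W0 HW] := @bounded_of_leading C F' n 1 r (1 + `|u|) n0 ler01 r0 (addr_ge0 ler01 (normr_ge0 _)).
have [K K0 HK] := ev_lipschitz0 (drop_poly n F) ler01.
have [L L0 HL] := poly_lipschitz (at0 (drop_poly n F)) 0.
have [y [y0 y1 yr KLy]] := pos_small r0 (addr_ge0 K0 L0).
exists W => // x x0.
have [m [m0 mx my]] := pos_min x0 y0.
(* The bound [m' <= m ^+ l] makes the l-th root of [s] smaller than [m]. *)
have [m' [m'0 m'm m'l]] := pos_min m0 (exprn_gt0 l m0).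
have [s [w [[s0 sm Fm Gm] wm]]] := H m' m'0; rewrite subr0 in wm.
pose t := l.-root s; have ts : t ^+ l = s by rewrite rootCK.
have t0 : t != 0 by apply: contraNneq s0 => t0; rewrite -ts t0 expr0n gtn_eqF.
have tm : `|t| < m.
  have : `|t| ^+ l < m ^+ l by rewrite -normrX ts (lt_le_trans sm).
  by rewrite ltr_pXn2r // nnegrE ?normr_ge0 ?ltW.
have m1 : m <= 1 by rewrite (le_trans my).
have t1 : `|t| <= 1 by rewrite ltW // (lt_le_trans tm).
have tw : t ^+ k * (w / t ^+ k) = w by rewrite mulrC divfK // expf_neq0.
exists t, (w / t ^+ k); split.
  split => //; first exact: lt_le_trans mx.
  - rewrite (pullback_ratio _ pbF Ea t0) tw ts (lt_le_trans Fm) //.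
    exact: le_trans mx.
  - rewrite (pullback_ratio _ pbG Eb t0) tw ts (lt_le_trans Gm) //.
    exact: le_trans mx.
apply: (HW t) => //.
  have := pullback_ev t (w / t ^+ k) (drop_pullback pbF); rewrite expr0 mulr1 tw ts => ->.
  have s1 : `|s| <= 1 by rewrite ltW // (lt_le_trans sm) // (le_trans m'm).
  have w1 : `|w| <= 1 by rewrite ltW // (lt_le_trans wm) // (le_trans m'm).
  have E : (at0 (drop_poly n F)).[0] = (F`_n).[0].
    by rewrite horner_coef0 coef_at0 coef_drop_poly.
  have d1 : `|ev (drop_poly n F) s w - (F`_n).[0]| <= r.
    rewrite -E -[X in `|X|](subrKA (ev (drop_poly n F) 0 w)) -at0E.
    rewrite (le_trans (ler_normD _ _)) // (le_trans _ (ltW KLy)) // mulrDl lerD //.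
      rewrite at0E (le_trans (HK _ _ s1 w1)) // ler_wpM2l // ltW //.
      by rewrite (lt_le_trans sm) // (le_trans m'm).
    have := HL w; rewrite subr0 => /(_ w1) le; rewrite (le_trans le) // ler_wpM2l // ltW //.
    by rewrite (lt_le_trans wm) // (le_trans m'm).
  have : `|(F`_n).[0]| <= `|ev (drop_poly n F) s w| + r.
    rewrite -[(F`_n).[0]](subKr (ev (drop_poly n F) s w)) (le_trans (ler_normB _ _)) //.
    by rewrite lerD2l.
  by rewrite -lerBlDr {1}[`|(F`_n).[0]|]splitr addrK.
have Fm1 : `|ev F' t (w / t ^+ k) / t ^+ a' - u| <= 1.
  by rewrite (pullback_ratio _ pbF Ea t0) tw ts ltW // (lt_le_trans Fm) // (le_trans m'm).
rewrite (le_trans (ratio_bound t0 t1 Fm1)) // ler_piMr ?addr_ge0 //.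
exact: exprn_ile1.
Qed.

Definition nonproper_ev P Q u v := forall x, 0 < x -> exists y z,
  [/\ x^-1 < `|y| + `|z|, `|ev P y z - u| < x & `|ev Q y z - v| < x].

Lemma homog_ratio n P t w : (size P <= n.+1)%N ->
  (forall j, (j <= n)%N -> (size (P`_j)%R <= (n - j).+1)%N) -> t != 0 ->
  ev (homog n P) t w / t ^+ n = ev P t^-1 (t^-1 * w).
Proof. by move=> sP sPj t0; rewrite -exprVn homog_ev. Qed.

Lemma drop_homog n P (A : C) : P`_n = A%:P -> drop_poly n (homog n P) = A%:P%:P.
Proof.
move=> E; apply/polyP => j; rewrite coef_drop_poly coef_poly coefC.
case: j => [|j]; last by rewrite ltnS leqNgt ltnS leq_addl.
rewrite add0n ltnSn subnn E; apply/polyP => i; rewrite coef_poly !coefC.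
by case: i.
Qed.

(** The constant top coefficient of P in y acts twice: bounded P and x would bound y, so x tends to
    infinity; and in [homog n P] it bounds w = y/x. Conversely, t -> 0 sends x = 1/t to infinity. *)
Lemma nonproper_limit n m P Q (A : C) u v : (0 < n)%N ->
  size P = n.+1 -> P`_n = A%:P -> A != 0 ->
  (forall j, (j <= n)%N -> (size (P`_j)%R <= (n - j).+1)%N) ->
  (size Q <= m.+1)%N -> (forall j, (j <= m)%N -> (size (Q`_j)%R <= (m - j).+1)%N) ->
  nonproper_ev P Q u v <-> limit_bd n m (homog n P) (homog m Q) u v.
Proof.
move=> n0 sP PA A0 sPj sQ sQj.
have sP' : (size P <= n.+1)%N by rewrite sP.
split=> [H|[W W0 H] x x0]; last first.
  have [t [w [[t0 tx Fx Gx] wW]]] := H x x0.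
  rewrite homog_ratio // in Fx; rewrite homog_ratio // in Gx.
  exists t^-1, (t^-1 * w); split => //.
  rewrite (@lt_le_trans _ _ `|t^-1|) ?lerDl // normfV ltf_pV2 //.
  by rewrite posrE normr_gt0.
have A1 : 0 < `|A| by rewrite normr_gt0.
have u1 : 0 <= 1 + `|u| by rewrite addr_ge0.
have [W W0 HW] := @bounded_of_leading C (homog n P) n 1 `|A| _ n0 ler01 A1 u1.
exists W => // x x0; have [x' [x'0 x'x x'1]] := pos_min x0 ltr01.
have x'V : 0 <= x'^-1 by rewrite invr_ge0 ltW.
have [Y Y0 HY] := @bounded_of_leading C P n x'^-1 `|A| _ n0 x'V A1 u1.
have xY : 0 < (x'^-1 + Y)^-1 by rewrite invr_gt0 ltr_wpDr // invr_gt0.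
have [m1 [m10 m11 m1x']] := pos_min xY x'0.
have [y [z [yz Py Qy]]] := H m1 m10.
have Py1 : `|ev P y z - u| <= 1 by rewrite ltW // (lt_le_trans Py) // (le_trans m1x').
have Pyu : `|ev P y z| <= 1 + `|u|.
  by rewrite -[ev P y z](subrK u) (le_trans (ler_normD _ _)) // lerD2r.
have dP : drop_poly n P = A%:P%:P.
  apply/polyP => j; rewrite coef_drop_poly coefC; case: j => [|j]; rewrite ?add0n //.
  by rewrite nth_default // sP addSn ltnS leq_addl.
(* Otherwise [z] would be bounded by [Y], against the choice of [m1]. *)
have yx : x'^-1 < `|y|.
  rewrite real_ltNge ?normr_real ?gtr0_real ?invr_gt0 //; apply/negP => yx.
  have zY : `|z| <= Y by apply: (HY y) => //; rewrite dP evC hornerC.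
  have : x'^-1 + Y < x'^-1 + Y.
    rewrite (@le_lt_trans _ _ m1^-1) ?(lt_le_trans yz) ?lerD //.
    by rewrite -[X in X <= _]invrK lef_pV2 // posrE // invr_gt0 ltr_wpDr // invr_gt0.
  by rewrite ltxx.
have y0 : y != 0 by rewrite -normr_gt0 (le_lt_trans x'V).
have tx : `|y^-1| < x' by rewrite normfV -[x']invrK ltf_pV2 // posrE ?invr_gt0 ?normr_gt0.
have yV0 : y^-1 != 0 by rewrite invr_eq0.
have E : y^-1^-1 * (z / y) = z by rewrite invrK mulrC divfK.
have RP := homog_ratio (z / y) sP' sPj yV0.
have RQ := homog_ratio (z / y) sQ sQj yV0.
rewrite E invrK in RP RQ.
exists y^-1, (z / y); split.
  split => //; first exact: lt_le_trans x'x.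
  - by rewrite RP (lt_le_trans Py) // (le_trans m1x').
  - by rewrite RQ (lt_le_trans Qy) // (le_trans m1x').
have t1 : `|y^-1| <= 1 by rewrite ltW // (lt_le_trans tx).
apply: (HW y^-1) => //; first by rewrite (drop_homog PA) evC hornerC.
rewrite (le_trans (@ratio_bound n _ u _ _ yV0 t1 _)) ?RP // ler_piMr //.
exact: exprn_ile1.
Qed.

End LimitSets.

(** * Newton descent *)

Section Descent.
Variable C : numClosedFieldType.
Variables (d e : nat) (A B : C).
Hypotheses (d0 : (0 < d)%N) (e0 : (0 < e)%N) (cop : coprime d e).
Hypotheses (A0 : A != 0) (B0 : B != 0).
Implicit Types (F G : {poly {poly C}}) (p q : {poly C}) (u v z c : C).

(** The leading coefficients are fixed only up to a rescaling of the parameter; [good_curve_rescale]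
    normalises them to A and B. *)
Definition good_curve (g : {poly C} * {poly C}) := exists m,
  [/\ (0 < m)%N, size g.1 = (m * d).+1, size g.2 = (m * e).+1 &
      lead_coef g.1 ^+ e * B ^+ d = A ^+ e * lead_coef g.2 ^+ d].

Definition curve_point (g : {poly C} * {poly C}) u v :=
  exists xi, u = g.1.[xi] /\ v = g.2.[xi].

Definition covered (S : C -> C -> Prop) := exists s : seq ({poly C} * {poly C}),
  {in s, forall g, good_curve g} /\
  forall u v, S u v <-> exists2 g, g \in s & curve_point g u v.

Lemma covered_ext (S T : C -> C -> Prop) : (forall u v, S u v <-> T u v) ->
  covered S -> covered T.
Proof.
by move=> ST [s [gs Hs]]; exists s; split=> // u v; rewrite -ST.
Qed.

Lemma covered_empty (S : C -> C -> Prop) : (forall u v, ~ S u v) -> covered S.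
Proof. by move=> S0; exists [::]; split=> // u v; split=> [/S0|[]]. Qed.

Lemma covered_union (rs : seq C) (S : C -> C -> C -> Prop) :
  {in rs, forall z, covered (S z)} ->
  covered (fun u v => exists2 z, z \in rs & S z u v).
Proof.
elim: rs => [|z rs IH] H; first by apply: covered_empty => u v [].
have [s1 [g1 H1]] := H z (mem_head _ _).
case: IH => [y ys|s2 [g2 H2]]; first by apply: H; rewrite inE ys orbT.
exists (s1 ++ s2); split=> [g|u v].
  by rewrite mem_cat => /orP [/g1|/g2].
split=> [[y]|[g]].
  rewrite inE => /orP [/eqP -> /H1 [g gs gp]|ys Sy].
    by exists g; rewrite ?mem_cat ?gs.
  have [|g gs gp] := (H2 u v).1; first by exists y.
  by exists g; rewrite ?mem_cat ?gs ?orbT.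
rewrite mem_cat => /orP [gs|gs] gp.
  by exists z; rewrite ?mem_head //; apply/H1; exists g.
have [|y ys Sy] := (H2 u v).2; first by exists g.
by exists y; rewrite ?inE ?ys ?orbT.
Qed.

(** At t = 0 the operator t d/dt vanishes, so [euler k] becomes multiplication by -k. *)
Lemma at0_wjac n m F G :
  at0 (wjac n m F G) = (at0 F)^`() * at0 G *+ m - at0 F * (at0 G)^`() *+ n.
Proof.
have eu k H : at0 (euler k H) = - (at0 H *+ k).
  apply/polyP => j; rewrite coef_at0 coef_euler coefN coefMn coef_at0.
  by rewrite hornerD hornerN hornerM hornerX mulr0 hornerMn add0r.
have -> : at0 (wjac n m F G) = at0 (euler n F) * at0 G^`() - at0 F^`() * at0 (euler m G).
  by rewrite /at0 /wjac rmorphB !rmorphM.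
by rewrite !eu /at0 -!deriv_map; ring.
Qed.

(* At t = 0 the weighted Jacobian gives a constant multiple of e p' q - d p q', which
   cannot be a nonzero constant at a common root of p and q. *)
Lemma node_covered M a F G c K : (0 < a)%N -> c != 0 ->
  wjac (a * d) (a * e) F G = (c *: 'X^K)%:P ->
  size (at0 F) = (M * d).+1 -> size (at0 G) = (M * e).+1 ->
  lead_coef (at0 F) ^+ e * B ^+ d = A ^+ e * lead_coef (at0 G) ^+ d ->
  (forall z N p1 q1, (0 < N <= M)%N ->
     at0 F = p1 * ('X - z%:P) ^+ (N * d) -> at0 G = q1 * ('X - z%:P) ^+ (N * e) ->
     p1.[z] != 0 -> q1.[z] != 0 -> p1.[z] ^+ e * B ^+ d = A ^+ e * q1.[z] ^+ d ->
     covered (limit_at (a * d) (a * e) (shift z F) (shift z G) 0)) ->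
  covered (limit_bd (a * d) (a * e) F G).
Proof.
move=> a0 c0 W sF sG L H.
have ad0 : (0 < a * d)%N by rewrite muln_gt0 a0.
have ae0 : (0 < a * e)%N by rewrite muln_gt0 a0.
have F0 : at0 F != 0 by rewrite -size_poly_gt0 sF.
have node u v := limit_bd_node G u v ad0 ae0 F0.
have := congr1 (@at0 C) W; rewrite at0_wjac [RHS]map_polyC /= /horner_eval => W0.
case: K {W} W0 => [|K] W0.
  apply: covered_empty => u v /node [z [/eqP Fz /eqP Gz _]].
  have := congr1 (fun f => f.[z]) W0.
  rewrite hornerD hornerN !hornerMn !hornerM Fz Gz mul0r mulr0 !mul0rn subr0.
  by rewrite !hornerC hornerZ hornerC mulr1 => /esym/eqP; rewrite (negPf c0).
have {}W0 : at0 F * (at0 G)^`() *+ d = (at0 F)^`() * at0 G *+ e.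
  have a1 : (a%:R : C) != 0 by rewrite pnatr_eq0 -lt0n.
  apply: (scalerI a1); rewrite !scaler_nat -!mulrnA [(d * a)%N]mulnC [(e * a)%N]mulnC.
  apply/esym/eqP; rewrite -subr_eq0 W0 hornerZ hornerXn expr0n mulr0.
  by rewrite polyC0.
have prop := proportional_powers d0 e0 sF sG L W0.
have [rs E] := closed_field_poly_normal (at0 F).
have rsE z : root (at0 F) z = (z \in rs).
  by rewrite E rootZ ?lead_coef_eq0 // root_prod_XsubC.
apply: (@covered_ext (fun u v => exists2 z, z \in rs &
   limit_at (a * d) (a * e) (shift z F) (shift z G) 0 u v)).
  move=> u v; rewrite node; split=> [[z zs /limit_at_shift Hz]|[z [rz _ Hz]]].
    exists z; split => //; first by rewrite rsE.
    exact: limit_at_root (limit_at_swap Hz).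
  by exists z; [rewrite -rsE|apply/limit_at_shift].
apply: covered_union => z; rewrite -rsE => rz.
have [N [p1 [q1 [NM Ep Eq [p1z q1z] L1]]]] := proportional_multiplicities d0 e0 cop A0 B0 sF sG prop rz.
exact: (H z N p1 q1).
Qed.

(** Points beyond [n] lie strictly above the Newton line since k > 0, while the point at [n] has
    order 0 and survives as leading term. *)
Lemma at0_pullback k l n F F' : (0 < k)%N -> (0 < l)%N -> (F`_n).[0] != 0 ->
  (forall j, F`_j != 0 -> (k * n = l * ord0p F`_j + k * j)%N -> (F'`_j).[0] = (low F`_j).[0]) ->
  (forall j, (F'`_j).[0] != 0 -> F`_j != 0 /\ (k * n = l * ord0p F`_j + k * j)%N) ->
  size (at0 F') = n.+1 /\ lead_coef (at0 F') = (F`_n).[0].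
Proof.
move=> k0 l0 Fn H1 H2.
have ord0 : ord0p F`_n = 0%N by rewrite ord0p_eq0.
have E : (at0 F')`_n = (F`_n).[0].
  rewrite coef_at0 H1 ?ord0 ?muln0 //; last first.
    by apply: contraNneq Fn => ->; rewrite horner0.
  by rewrite {2}[F`_n]low_ord ord0 expr0 mulr1.
have s : size (at0 F') = n.+1.
  apply/eqP; rewrite eqn_leq; apply/andP; split.
    apply/leq_sizeP => j lt; rewrite coef_at0; apply/eqP; apply: contraT => /H2 [_].
    have : (k * n < k * j)%N by rewrite ltn_pmul2l.
    by move: (k * n)%N (k * j)%N (l * _)%N => x y w; lia.
  by rewrite ltnNge; apply/negP => le; move: Fn; rewrite -E nth_default ?eqxx.
by split=> //; rewrite lead_coefE s.
Qed.

Lemma shift_factor_coef z n p1 F : at0 F = p1 * ('X - z%:P) ^+ n ->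
  (forall j, (j < n)%N -> ((shift z F)`_j).[0] = 0) /\ ((shift z F)`_n).[0] = p1.[z].
Proof.
move=> E.
have E1 : at0 (shift z F) = (p1 \Po ('X + z%:P)) * 'X^n.
  rewrite at0_shift E comp_polyM; congr (_ * _).
  by rewrite rmorphXn /= comp_polyB comp_polyX comp_polyC addrK.
split=> [j lt|]; rewrite -coef_at0 E1 coefMXn ?lt // ltnn subnn.
by rewrite -horner_coef0 horner_comp hornerD hornerX hornerC add0r.
Qed.

(** In characteristic 0 this coefficient detects z != 0. *)
Lemma coef_XsubC_exp_pred z n : (('X - z%:P) ^+ n.+1)`_n = - z *+ n.+1.
Proof.
elim: n => [|n IH]; first by rewrite expr1 coefB coefX coefC sub0r.
rewrite exprS mulrBl coefB coefXM coefCM /= IH [X in _ - _ * X](_ : _ = 1).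
  by rewrite mulr1 -mulrSr.
have /monicP := monic_exp n.+1 (monicXsubC z).
by rewrite lead_coefE size_exp_XsubC.
Qed.

(** The points of the Newton diagram left of [n], as height and distance to [n]. *)
Definition slopes n F := [seq (ord0p F`_j, n - j)%N | j <- iota 0 n & F`_j != 0].

Lemma slopesP n F vs : reflect
  (exists j, [/\ (j < n)%N, F`_j != 0 & vs = (ord0p F`_j, n - j)%N]) (vs \in slopes n F).
Proof.
apply: (iffP mapP) => [[j]|[j [lt nz ->]]].
  by rewrite mem_filter mem_iota => /andP [nz /andP [_ lt]] ->; exists j.
by exists j; rewrite // mem_filter mem_iota nz.
Qed.

Lemma slope_bound k l n F : {in slopes n F, forall vs, (k * vs.2 <= l * vs.1)%N} ->
  forall j, F`_j != 0 -> (k * n <= l * ord0p F`_j + k * j)%N.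
Proof.
move=> H j nz; case: (ltnP j n) => [lt|le]; last first.
  by rewrite (@leq_trans (k * j)) ?leq_addl // leq_mul2l le orbT.
have /H /= : (ord0p F`_j, n - j)%N \in slopes n F by apply/slopesP; exists j.
by rewrite mulnBr leq_subLR addnC.
Qed.

(* Induction on (M, a), lexicographically: after the substitution with coprime slope
   k/l, a root of full multiplicity M is nonzero, so the coefficient of w^(Md-1) does
   not vanish, which forces l = 1 and a' = a - k M < a. *)
Lemma branch_covered M : forall a F G c K, (0 < M)%N -> (0 < a)%N -> c != 0 ->
  wjac (a * d) (a * e) F G = (c *: 'X^K)%:P ->
  (forall j, (j < M * d)%N -> (F`_j).[0] = 0) -> (F`_(M * d)).[0] != 0 ->
  (forall j, (j < M * e)%N -> (G`_j).[0] = 0) -> (G`_(M * e)).[0] != 0 ->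
  (F`_(M * d)).[0] ^+ e * B ^+ d = A ^+ e * (G`_(M * e)).[0] ^+ d ->
  covered (limit_at (a * d) (a * e) F G 0).
Proof.
elim/ltn_ind: M => M IHM a; elim/ltn_ind: a => a IHa F G c K.
move=> M0 a0 c0 W Flow Fn Glow Gn L.
pose s := (a, M) :: slopes (M * d) F ++ slopes (M * e) G.
have spos : {in s, forall vs, (0 < vs.1)%N && (0 < vs.2)%N}.
  move=> vs; rewrite inE mem_cat => /orP [/eqP -> /=|/orP [] /slopesP [j [lt nz ->]] /=].
  - by rewrite a0.
  - by rewrite subn_gt0 lt ord0p_gt0 ?Flow.
  - by rewrite subn_gt0 lt ord0p_gt0 ?Glow.
have [k [l [k0 l0 kl smin [vs vss Evs]]]] := min_slope (isT : s != [::]) spos.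
have [|F' [pbF F1 F2]] := @pullback_exists C k l (k * (M * d)) F l0.
  by apply: slope_bound => x xs; apply: smin; rewrite inE mem_cat xs orbT.
have [|G' [pbG G1 G2]] := @pullback_exists C k l (k * (M * e)) G l0.
  by apply: slope_bound => x xs; apply: smin; rewrite inE mem_cat xs !orbT.
have [sF lF] := at0_pullback k0 l0 Fn F1 F2.
have [sG lG] := at0_pullback k0 l0 Gn G1 G2.
(* The pair (a, M) in s keeps the new pole orders nonnegative. *)
have kMla : (k * M <= l * a)%N by apply: (smin (a, M)); rewrite mem_head.
pose a' := (l * a - k * M)%N.
have Ea' : (a' + k * M = l * a)%N by rewrite subnK.
have Ea : (a' * d + k * (M * d) = l * (a * d))%N by rewrite !mulnA -mulnDl Ea'.
have Eb : (a' * e + k * (M * e) = l * (a * e))%N by rewrite !mulnA -mulnDl Ea'.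
have n0 : (0 < M * d)%N by rewrite muln_gt0 M0.
have [c' c'0 [K' W']] := wjac_pullback pbF pbG Ea Eb l0 c0 W.
apply: (@covered_ext (limit_bd (a' * d) (a' * e) F' G')).
  by move=> u v; symmetry; apply: limit_pullback pbF pbG Ea Eb.
clearbody a'; case: (posnP a') => [az|a'0].
  (* Both pole orders are 0, so the cluster values form a single curve. *)
  exists [:: (at0 F', at0 G')]; split=> [g|u v].
    by rewrite inE => /eqP ->; exists M; split=> //=; rewrite lF lG.
  rewrite az !mul0n limit_bd_leaf ?sF ?ltnS //; split=> [H|[g]].
    by exists (at0 F', at0 G'); rewrite ?mem_head.
  by rewrite inE => /eqP ->.
apply: (node_covered a'0 c'0 W' sF sG); first by rewrite lF lG.
move=> z N p1 q1 /andP [N0 NM] Ep Eq p1z q1z L1.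
have [Sp1 Sp2] := shift_factor_coef Ep; have [Sq1 Sq2] := shift_factor_coef Eq.
have WS : wjac (a' * d) (a' * e) (shift z F') (shift z G') = (c' *: 'X^K')%:P.
  by rewrite wjac_shift W' /shift comp_polyC.
move: NM; rewrite leq_eqVlt => /orP [/eqP EN|lt]; last first.
  by apply: (IHM N lt a' _ _ c' K') => //; rewrite ?Sp2 ?Sq2.
suff lta : (a' < a)%N.
  rewrite EN in Sp1 Sp2 Sq1 Sq2.
  by apply: (IHa a' lta _ _ c' K') => //; rewrite ?Sp2 ?Sq2.
suff l1 : l = 1%N.
  by move: Ea'; rewrite l1 mul1n => <-; rewrite -[X in (X < _)%N]addn0 ltn_add2l muln_gt0 k0.
(* If (a, M) attained the slope, a' would be 0. So a point of F or G attains it, giving [at0 F'] or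
   [at0 G'] a nonzero coefficient below the top; it is then not a pure power of w. *)
have z0 : z != 0.
  have contra n (f f' : {poly {poly C}}) r (E : at0 f' = r * ('X - z%:P) ^+ n)
      (H1 : forall j, f`_j != 0 -> (k * n = l * ord0p f`_j + k * j)%N -> (f'`_j).[0] = (low f`_j).[0])
      (H : vs \in slopes n f) : z != 0.
    apply: contraL H => /eqP z0; apply/slopesP => -[j [lt nz Ev]].
    have : (at0 f')`_j != 0.
      rewrite coef_at0 H1 ?low_neq0 //; move: Evs; rewrite Ev /= mulnBr => Ekl.
      by rewrite -Ekl subnK // leq_mul2l (ltnW lt) orbT.
    by rewrite E z0 subr0 coefMXn lt eqxx.
  move: vss; rewrite inE mem_cat => /orP [/eqP Ev|/orP [Hvs|Hvs]].
  - by move: a'0 Ea'; rewrite Ev /= in Evs; rewrite Evs => a'0 Ea'; lia.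
  - by apply: contra F1 Hvs; rewrite Ep EN.
  - by apply: contra G1 Hvs; rewrite Eq EN.
have [r Er] : exists r, p1 = r%:P.
  have p10 : p1 != 0 by apply: contraNneq p1z => ->; rewrite horner0.
  have : (0 < size p1)%N by rewrite size_poly_gt0.
  have := sF; rewrite Ep size_proper_mul ?size_exp_XsubC ?EN; last first.
    by rewrite (monicP (monic_exp _ (monicXsubC z))) mulr1 lead_coef_eq0.
  rewrite addnS /= => H H0; exists (p1`_0); apply: size1_polyC.
  by move: H H0; move: (size p1) (M * d)%N => x y; lia.
(* The neighbour of the top point therefore lies on the Newton line, so k is l times its order and l
   divides k. *)
have nzc : (F'`_(M * d).-1).[0] != 0.
  rewrite -coef_at0 Ep Er EN -{1}(prednK n0) coefCM coef_XsubC_exp_pred.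
  rewrite mulf_neq0 //; first by move: p1z; rewrite Er hornerC.
  by rewrite -mulr_natr mulf_neq0 ?oppr_eq0 // pnatr_eq0.
have [_ Ek] := F2 _ nzc.
have : (l %| k)%N.
  have -> : k = (l * ord0p F`_(M * d).-1)%N.
    by move: Ek; rewrite -{1}(prednK n0) mulnS; move: (k * _)%N (l * _)%N => x y; lia.
  exact: dvdn_mulr.
by move: kl; rewrite /coprime => /eqP kl /gcdn_idPr; rewrite kl.
Qed.

End Descent.

(** * The non-proper value set *)

Section CoveringTheorem.
Variable C : numClosedFieldType.
Variables (d e : nat) (A B : C).
Hypotheses (d0 : (0 < d)%N) (e0 : (0 < e)%N) (cop : coprime d e).
Hypotheses (A0 : A != 0) (B0 : B != 0).

(** At t = 0 there remains the degree-n form of P at x = 1. *)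
Lemma at0_homog n (P : {poly {poly C}}) a : P`_n = a%:P -> a != 0 ->
  size (at0 (homog n P)) = n.+1 /\ lead_coef (at0 (homog n P)) = a.
Proof.
move=> E a0.
have En : (at0 (homog n P))`_n = a.
  rewrite coef_at0; have := congr1 (fun f : {poly {poly C}} => f`_0) (drop_homog E).
  by rewrite coef_drop_poly add0n coefC => ->; rewrite hornerC.
have s : size (at0 (homog n P)) = n.+1.
  apply/eqP; rewrite eqn_leq; apply/andP; split.
    apply/leq_sizeP => j lt; rewrite coef_at0 coef_poly ltnS leqNgt lt horner0 //.
  by rewrite ltnNge; apply/negP => le; move: a0; rewrite -En nth_default ?eqxx.
by split=> //; rewrite lead_coefE s.
Qed.

(** The chart at infinity is a first node with pole orders K d and K e; each common root starts the
    Newton induction at (N, K). *)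
Lemma nonproper_covered K (P Q : {poly {poly C}}) c : (0 < K)%N ->
  size P = (K * d).+1 -> P`_(K * d) = A%:P ->
  (forall j, (j <= K * d)%N -> (size (P`_j)%R <= (K * d - j).+1)%N) ->
  size Q = (K * e).+1 -> Q`_(K * e) = B%:P ->
  (forall j, (j <= K * e)%N -> (size (Q`_j)%R <= (K * e - j).+1)%N) ->
  map_poly (@deriv C) P * Q^`() - P^`() * map_poly (@deriv C) Q = c%:P%:P -> c != 0 ->
  covered d e A B (nonproper_ev P Q).
Proof using d0 e0 cop A0 B0.
move=> K0 sP PA sPj sQ QB sQj J c0.
have sP' : (size P <= (K * d).+1)%N by rewrite sP.
have sQ' : (size Q <= (K * e).+1)%N by rewrite sQ.
have n0 : (0 < K * d)%N by rewrite muln_gt0 K0.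
have [k W] := wjac_homog sP' sPj sQ' sQj J c0.
have Nc0 : - c != 0 by rewrite oppr_eq0.
have [sF lF] := at0_homog PA A0; have [sG lG] := at0_homog QB B0.
apply: (@covered_ext _ _ _ _ _ (limit_bd (K * d) (K * e) (homog (K * d) P) (homog (K * e) Q))).
  by move=> u v; symmetry; apply: (nonproper_limit _ _ n0 sP PA A0).
apply: (node_covered d0 e0 cop A0 B0 K0 Nc0 W sF sG); first by rewrite lF lG.
move=> z N p1 q1 /andP [N0 NM] Ep Eq p1z q1z L1.
have [Sp1 Sp2] := shift_factor_coef Ep; have [Sq1 Sq2] := shift_factor_coef Eq.
apply: (@branch_covered _ _ _ _ _ d0 e0 cop A0 B0 N K _ _ (- c) k) => //; rewrite ?Sp2 ?Sq2 //.
by rewrite wjac_shift W /shift comp_polyC.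
Qed.

Lemma good_curve_rescale g : good_curve d e A B g -> exists m (p q : {poly C}),
  [/\ size p = (m * d).+1, lead_coef p = A, size q = (m * e).+1, lead_coef q = B &
      forall u v, curve_point g u v <-> exists xi, u = p.[xi] /\ v = q.[xi]].
Proof using d0 e0 cop A0 B0.
move=> [m [m0 sp sq L]]; move: g sp sq L => [p q] /= sp sq L.
have lp : lead_coef p != 0 by rewrite lead_coef_eq0 -size_poly_gt0 sp.
have lq : lead_coef q != 0 by rewrite lead_coef_eq0 -size_poly_gt0 sq.
pose s := A / lead_coef p; pose t := B / lead_coef q.
have s0 : s != 0 by rewrite mulf_neq0 ?invr_eq0.
have t0 : t != 0 by rewrite mulf_neq0 ?invr_eq0.
have st : s ^+ e = t ^+ d.
  rewrite /s /t !expr_div_n; apply/eqP; rewrite eqr_div ?expf_neq0 //.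
  by rewrite -L mulrC.
have [mu mud mue] : exists2 mu, mu ^+ d = s & mu ^+ e = t.
  case: (egcdnP e d0) => x y; rewrite (eqP cop) => E _.
  (* Bezout in the form x d = y e + 1, combined with s^e = t^d. *)
  exists (s ^+ x / t ^+ y).
    rewrite expr_div_n -!exprM E exprD expr1 [(y * d)%N]mulnC [(t ^+ _)]exprM -st -exprM mulnC.
    by rewrite mulrC mulKf // expf_neq0.
  rewrite expr_div_n -!exprM [(x * e)%N]mulnC exprM st -exprM mulnC E exprD expr1.
  by rewrite mulrC mulKf // expf_neq0.
pose la := m.-root mu; have lam : la ^+ m = mu by rewrite rootCK.
have la0 : la != 0.
  apply: contraNneq s0 => la0; rewrite -mud -lam la0 -exprM expr0n.
  by rewrite gtn_eqF // muln_gt0 m0.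
have sX : size (la *: 'X) = 2 by rewrite size_scale ?size_polyX.
have lX : lead_coef (la *: 'X) = la by rewrite lead_coefZ lead_coefX mulr1.
exists m, (p \Po (la *: 'X)), (q \Po (la *: 'X)); split.
- by rewrite size_comp_poly2.
- by rewrite lead_coef_comp ?sX // lX sp /= exprM lam mud /s mulrC divfK.
- by rewrite size_comp_poly2.
- by rewrite lead_coef_comp ?sX // lX sq /= exprM lam mue /t mulrC divfK.
- move=> u v; split=> -[xi [-> ->]] /=.
    exists (xi / la); rewrite !horner_comp !hornerZ hornerX.
    by rewrite [la * _]mulrC divfK.
  by exists (la * xi); rewrite !horner_comp !hornerZ hornerX.
Qed.

End CoveringTheorem.

(** * Polynomial curves as irreducible Zariski-closed sets *)

Section ZariskiCurves.
Variable R : realType.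
Local Notation C := (R[i]).
Implicit Types (p q : {poly C}) (G H : {poly {poly C}}) (Z : C * C -> Prop).

Lemma eval2E G (x y : C) : eval2 G x y = ev G x y.
Proof. by []. Qed.

Definition curve p q : C * C -> Prop := fun z => exists xi, z = (p.[xi], q.[xi]).

Definition on_curve G p q : {poly C} := (map_poly (comp_poly p) G).[q].

Lemma horner_on_curve G p q xi : (on_curve G p q).[xi] = eval2 G p.[xi] q.[xi].
Proof.
rewrite eval2E (@ev_coef _ _ _ _ (size G)) // /on_curve.
rewrite (@horner_coef_wide _ (size G) (map_poly _ G)) ?size_poly // horner_sum.
by apply: eq_bigr => j _; rewrite coef_map /= hornerM horner_comp horner_exp.
Qed.

(* The resultant of p - x and q - y in the parameter vanishes exactly on the curve. *)
Lemma curve_closed p q : (1 < size p)%N -> (1 < size q)%N -> zariski_closed (curve p q).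
Proof.
move=> sp sq; pose cst := map_poly ((polyC \o polyC) : C -> {poly {poly C}}).
pose ph : {poly {poly {poly C}}} := cst p - ('X%:P)%:P.
pose qh : {poly {poly {poly C}}} := cst q - 'X%:P.
pose f (u v : C) : {rmorphism {poly {poly C}} -> C} := (horner_eval u \o horner_eval v%:P).
have fE u v G : f u v G = eval2 G u v by [].
have szc (r : {poly C}) : size (cst r) = size r.
  by rewrite size_map_inj_poly // => x y /polyC_inj /polyC_inj.
(* The leading coefficients are nonzero constants, so the resultant commutes with specialisation at
   (u, v). *)
have lead (r : {poly C}) (x : {poly {poly C}}) u v : (1 < size r)%N ->
    f u v (lead_coef (cst r - x%:P)) != 0.
  move=> sr; rewrite lead_coefDl; last first.
    by rewrite size_polyN szc (leq_ltn_trans (size_polyC_leq1 _)).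
  rewrite lead_coef_map_inj ?fE //; last by move=> y z /polyC_inj /polyC_inj.
  by rewrite /eval2 !hornerC lead_coef_eq0 -size_poly_gt0 (ltnW sr).
have mapf (r : {poly C}) (x : {poly {poly C}}) u v :
    map_poly (f u v) (cst r - x%:P) = r - (eval2 x u v)%:P.
  rewrite rmorphB /= map_polyC; congr (_ - _).
  by rewrite -map_poly_comp map_poly_id // => y _ /=; rewrite /horner_eval !hornerC.
have res u v : (eval2 (resultant ph qh) u v == 0) = (1 < size (gcdp (p - u%:P) (q - v%:P)))%N.
  rewrite -fE map_resultant ?lead // resultant_eq0 !mapf.
  by rewrite /eval2 !hornerE.
have nz u : p - u%:P != 0.
  apply: contraTneq sp => /eqP; rewrite subr_eq0 => /eqP ->.
  by rewrite -leqNgt size_polyC_leq1.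
have common u v xi : root (gcdp (p - u%:P) (q - v%:P)) xi = (u == p.[xi]) && (v == q.[xi]).
  by rewrite root_gcd /root !hornerE !subr_eq0 ![_ == p.[xi]]eq_sym ![_ == q.[xi]]eq_sym.
(* All equations satisfied by the curve are taken; the resultant is one of them. *)
exists (fun G => forall xi, eval2 G p.[xi] q.[xi] = 0) => -[u v] /=.
split=> [[xi [-> ->]] G|Hz]; first exact.
have /eqP : eval2 (resultant ph qh) u v = 0.
  apply: Hz => xi; apply/eqP; rewrite res (@root_size_gt1 _ xi) //.
    by rewrite gcdp_eq0 negb_and nz.
  by rewrite common !eqxx.
rewrite res => sg.
have /closed_rootP [xi] : size (gcdp (p - u%:P) (q - v%:P)) != 1%N by rewrite gtn_eqF.
by rewrite common => /andP [/eqP -> /eqP ->]; exists xi.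
Qed.

(** Equations of [Z1] and [Z2] that fail on the curve pull back to nonzero polynomials in the
    parameter; a non-root of their product gives a point outside both. *)
Lemma curve_irreducible p q : (1 < size p)%N -> (1 < size q)%N -> irreducible_closed (curve p q).
Proof.
move=> sp sq; split; first exact: curve_closed.
split; first by exists (p.[0], q.[0]), 0.
move=> Z1 Z2 [F1 H1] [F2 H2] E.
have sub1 z : Z1 z -> curve p q z by move=> h; apply/E; left.
have sub2 z : Z2 z -> curve p q z by move=> h; apply/E; right.
have [c1|n1] := pselect (forall z, curve p q z -> Z1 z); first by left=> z; split; auto.
have [c2|n2] := pselect (forall z, curve p q z -> Z2 z); first by right=> z; split; auto.
have nonzero (Z' : C * C -> Prop) (F : {poly {poly C}} -> Prop) :
    (forall z, Z' z <-> (forall G, F G -> eval2 G z.1 z.2 = 0)) ->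
    ~ (forall z, curve p q z -> Z' z) -> exists2 G, F G & on_curve G p q != 0.
  move=> HZ /existsNP [z /not_implyP [[xi ->] nz]].
  have {nz} /existsNP [G /not_implyP [FG nz]] : ~ (forall G, F G -> eval2 G p.[xi] q.[xi] = 0).
    by move=> h; apply: nz; apply/HZ.
  exists G => //; apply/eqP => E0; apply: nz.
  by rewrite -horner_on_curve E0 horner0.
have [G1 FG1 nz1] := nonzero _ _ H1 n1; have [G2 FG2 nz2] := nonzero _ _ H2 n2.
have /closed_nonrootP [xi] : on_curve G1 p q * on_curve G2 p q != 0 by rewrite mulf_neq0.
rewrite /root hornerM mulf_eq0 negb_or !horner_on_curve => /andP [/eqP n1' /eqP n2'].
have [/H1/(_ G1 FG1)//|/H2/(_ G2 FG2)//] := (E (p.[xi], q.[xi])).1 (ex_intro _ xi erefl).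
Qed.

Lemma irreducible_prime Z G H : irreducible_closed Z ->
  (forall z, Z z -> eval2 G z.1 z.2 * eval2 H z.1 z.2 = 0) ->
  (forall z, Z z -> eval2 G z.1 z.2 = 0) \/ (forall z, Z z -> eval2 H z.1 z.2 = 0).
Proof.
move=> [[F HF] [_ irr]] GH.
have cut K : zariski_closed (fun z => Z z /\ eval2 K z.1 z.2 = 0).
  exists (fun K' => F K' \/ K' = K) => z; split=> [[/HF Fz Kz] K' [/Fz//|->//]|h].
  by split; [apply/HF => K' FK'; apply: h; left|apply: h; right].
have [] := irr _ _ (cut G) (cut H).
- move=> z; split=> [Zz|[[]|[]]//].
  by have /eqP := GH z Zz; rewrite mulf_eq0 => /orP [] /eqP h; [left|right].
- by move=> h; left=> z /h [].
- by move=> h; right=> z /h [].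
Qed.

(** If no [S i] contained [Z], each would have an equation failing somewhere on [Z]. Their product
    vanishes on the union, hence on [Z], against primality. *)
Lemma irreducible_sub_union Z (T : eqType) (s : seq T) (S : T -> C * C -> Prop) :
  irreducible_closed Z -> {in s, forall i, zariski_closed (S i)} ->
  (forall z, Z z -> exists2 i, i \in s & S i z) ->
  exists2 i, i \in s & forall z, Z z -> S i z.
Proof.
move=> irr closedS cover; apply: contrapT => none.
suff [G Gs nG] : exists2 G, forall i z, i \in s -> S i z -> eval2 G z.1 z.2 = 0
    & ~ (forall z, Z z -> eval2 G z.1 z.2 = 0).
  by apply: nG => z Zz; have [i si Sz] := cover z Zz; apply: Gs Sz.
have {cover} : {in s, forall i, ~ (forall z, Z z -> S i z)}.
  by move=> i si h; apply: none; exists i.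
elim: s closedS {none} => [|i s IH] closedS none.
  exists 1 => // h; have [_ [[z Zz] _]] := irr; have /eqP := h z Zz.
  by rewrite /eval2 !hornerC oner_eq0.
case: IH => [j js|j js|G Gs nG].
- by apply: closedS; rewrite inE js orbT.
- by apply: none; rewrite inE js orbT.
have [F HF] := closedS i (mem_head _ _).
have /existsNP [z /not_implyP [Zz nz]] := none i (mem_head _ _).
have {nz} /existsNP [H /not_implyP [FH nz]] : ~ (forall K, F K -> eval2 K z.1 z.2 = 0).
  by move=> h; apply: nz; apply/HF.
exists (H * G).
  move=> j y; rewrite inE => /orP [/eqP ->|js] Sy; rewrite /eval2 !hornerM.
    by have /HF/(_ H FH) := Sy; rewrite /eval2 => ->; rewrite mul0r.
  by have := Gs j y js Sy; rewrite /eval2 => ->; rewrite mulr0.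
move=> h; have [//|h1|//] := @irreducible_prime Z H G irr.
- by move=> y /h; rewrite /eval2 !hornerM.
- by apply: nz; apply: h1.
Qed.

Lemma totdeg_coef (P : {poly {poly C}}) n : totdeg P = n ->
  forall j, (j <= n)%N -> (size (P`_j)%R <= (n - j).+1)%N.
Proof.
move=> E j le; have [->|nz] := eqVneq (P`_j) 0; first by rewrite size_poly0.
have ltj : (j < size P)%N.
  by rewrite ltnNge; apply: contra nz => /(nth_default 0) ->.
have := @leq_bigmax_cond _ (fun i : 'I_(size P) => P`_i != 0)
  (fun i : 'I_(size P) => ((size (P`_i)%R).-1 + i)%N) (Ordinal ltj) nz.
rewrite /= -[X in (_ <= X)%N]/(totdeg P) E => le2.
rewrite -(prednK (_ : 0 < size (P`_j)%R)%N) ?size_poly_gt0 // ltnS.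
by rewrite leq_subRL // addnC.
Qed.

Lemma RtoC_ReK (x : C) : 0 < x -> x = RtoC (complex.Re x) /\ 0 < complex.Re x.
Proof. by case: x => a b; rewrite ltcE /= => /andP [/eqP -> ->]. Qed.

Lemma ltRtoC (x y : R) : (RtoC x < RtoC y) = (x < y).
Proof. by rewrite /RtoC ltcE /= eqxx. Qed.

Lemma RtoCV (x : R) : RtoC (x^-1) = (RtoC x)^-1.
Proof. exact: (fmorphV (@real_complex R)). Qed.

Lemma RtoCn n : RtoC (n%:R : R) = n%:R.
Proof. exact: (rmorph_nat (@real_complex R)). Qed.

Lemma nonproper_setE (P Q : {poly {poly C}}) z :
  nonproper_set P Q z <-> nonproper_ev P Q z.1 z.2.
Proof.
split=> [[p [inf cvg]] x /RtoC_ReK [-> r0]|H].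
  have [N1 H1] := inf (complex.Re x)^-1; have [N2 H2] := cvg _ r0.
  pose n := maxn N1 N2; exists (p n).1, (p n).2.
  have {}H2 := H2 n (leq_maxr _ _).
  split; first by rewrite -RtoCV H1 // leq_maxl.
    by apply: le_lt_trans H2; rewrite lerDl.
  by apply: le_lt_trans H2; rewrite lerDr.
(* The two coordinate errors, each below 1/(2(n+1)), add up to less than 1/(n+1). *)
pose x n : C := (n.+1 + n.+1)%:R^-1.
have x0 n : 0 < x n by rewrite invr_gt0 ltr0n.
have /choice [p Hp] : forall n, exists ab : C * C,
    [/\ (x n)^-1 < `|ab.1| + `|ab.2|, `|ev P ab.1 ab.2 - z.1| < x n &
        `|ev Q ab.1 ab.2 - z.2| < x n].
  by move=> n; have [a [b Hab]] := H _ (x0 n); exists (a, b).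
exists p; split.
  move=> M; exists (Num.bound `|M|) => n le; have [lt _ _] := Hp n.
  apply: lt_trans lt; rewrite /x invrK -RtoCn ltRtoC.
  rewrite (le_lt_trans (ler_norm M)) // (lt_le_trans (archi_boundP _)) // ler_nat.
  by rewrite (leq_trans le) // (leq_trans (leqnSn _)) // leq_addr.
move=> r r0; exists (Num.bound r^-1) => n le; have [_ Pn Qn] := Hp n.
rewrite !eval2E (lt_trans (ltrD Pn Qn)) // /x.
have -> : (n.+1 + n.+1)%:R^-1 + (n.+1 + n.+1)%:R^-1 = RtoC (n.+1%:R^-1 : R).
  rewrite RtoCV RtoCn natrD; have : (n.+1%:R : C) != 0 by rewrite pnatr_eq0.
  move: (n.+1%:R : C) => y y0; field.
  by rewrite y0 -mulr2n -mulr_natr mulf_neq0 ?pnatr_eq0.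
rewrite ltRtoC invf_plt ?posrE ?ltr0n // (lt_le_trans (archi_boundP _)) ?invr_ge0 ?ltW //.
by rewrite ltr_nat.
Qed.

End ZariskiCurves.

Theorem theorem1 (R : realType) (P Q : {poly {poly R[i]}})
    (K d e : nat) (A B : R[i]) :
  (0 < K)%N -> (0 < d)%N -> (0 < e)%N -> gcdn d e = 1%N ->
  (exists c : R[i], c != 0 /\ jacobian P Q = (c%:P)%:P) ->
  totdeg P = (K * d)%N -> totdeg Q = (K * e)%N ->
  size P = (K * d).+1 -> lead_coef P = A%:P -> A != 0 ->
  size Q = (K * e).+1 -> lead_coef Q = B%:P -> B != 0 ->
  (exists a, nonproper_set P Q a) ->
  forall Z : R[i] * R[i] -> Prop, irreducible_component (nonproper_set P Q) Z ->
  exists (m : nat) (p q : {poly R[i]}),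
    [/\ size p = (m * d).+1, lead_coef p = A,
        size q = (m * e).+1, lead_coef q = B &
        forall z, Z z <-> exists xi : R[i], z = (p.[xi], q.[xi])].
Proof.
move=> K0 d0 e0 gde [c [c0 J]] dP dQ sP lP A0 sQ lQ B0 _ Z [irrZ [ZS maxZ]].
have cop : coprime d e by apply/eqP.
have PA : P`_(K * d) = A%:P by rewrite -lP lead_coefE sP.
have QB : Q`_(K * e) = B%:P by rewrite -lQ lead_coefE sQ.
have [s [gs Hs]] := nonproper_covered d0 e0 cop A0 B0 K0 sP PA (totdeg_coef dP)
  sQ QB (totdeg_coef dQ) J c0.
have sizes g : g \in s -> (1 < size g.1)%N /\ (1 < size g.2)%N.
  by move=> /gs [m [m0 -> -> _]]; rewrite !ltnS !muln_gt0 m0.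
have [g g_s Zg] : exists2 g, g \in s & forall z, Z z -> curve g.1 g.2 z.
  apply: irreducible_sub_union => // [g /sizes [s1 s2]|z /ZS]; first exact: curve_closed.
  move=> /nonproper_setE /Hs [g g_s [xi [E1 E2]]].
  by exists g => //; exists xi; case: z E1 E2 => u v /= -> ->.
have [s1 s2] := sizes g g_s.
(* The curve containing [Z] is irreducible and lies in the non-proper set, so maximality of [Z]
   gives equality. *)
have gZ z : curve g.1 g.2 z -> Z z.
  apply: (maxZ _ (curve_irreducible s1 s2)) => // y [xi ->].
  by apply/nonproper_setE/Hs; exists g => //; exists xi.
have [m [p [q [sp lp sq lq Epq]]]] := good_curve_rescale d0 e0 cop A0 B0 (gs g g_s).
exists m, p, q; split=> // -[u v]; split.
  move=> /Zg [xi [-> ->]]; have [|xi' [-> ->]] := (Epq g.1.[xi] g.2.[xi]).1.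
    by exists xi.
  by exists xi'.
move=> [xi [-> ->]]; have [|xi' [-> ->]] := (Epq p.[xi] q.[xi]).2; first by exists xi.
by apply: gZ; exists xi'.
Qed.
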